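(* Let $T$ be a tournament which is a lexicographic sum of acyclic tournaments indexed by a finite tournament, and let $k$ be the number of infinite acyclic components of $T$. Then the generating series $H_{\varphi_T}(x)=\sum_{n\ge 0}\varphi_T(n)x^n$ is a rational fraction of the form $$\frac{P(x)}{(1-x)(1-x^2)\cdots(1-x^k)}$$ with $P(x)\in\mathbb Z[x]$, and $\varphi_T(n)\simeq a n^{k-1}$ for some non-negative real $a$.
   Context: A tournament is a set with an irreflexive, antisymmetric, complete binary relation; acyclic means no $3$-cycle. A subset of vertices is autonomous if every vertex outside it either dominates all of it or is dominated by all of it. The acyclic component of a vertex $x$ is the union of all acyclic autonomous subsets containing $x$ (the largest such set); acyclic components partition the vertex set. The profile $\varphi_T(n)$ is the number of tournaments induced on $n$-element subsets of $V(T)$, up to isomorphism. Lexicographical sum $\sum_{i\in D}T_i$: vertex set the disjoint union of the $V(T_i)$, with $(x,i)\to(y,j)$ iff ($i=j$ and $x\to y$ in $T_i$) or $i\to j$ in $D$. $\simeq$ denotes asymptotic equivalence as $n\to\infty$. *)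

(* Defs.v *)
From mathcomp Require Import all_boot all_order all_algebra finmap.
From mathcomp Require Import all_classical all_reals all_analysis.
Set Implicit Arguments.
Unset Strict Implicit.
Unset Printing Implicit Defensive.
Import Order.TTheory GRing.Theory Num.Theory.
Import numFieldNormedType.Exports.
Local Open Scope classical_set_scope.
Local Open Scope ring_scope.
Local Open Scope card_scope.

(* [T x y] reads "x -> y" (x dominates y). *)
Record tournament (V : Type) := Tournament {
  dominates :> V -> V -> Prop;
  tournament_irreflexive : forall x, ~ dominates x x;
  tournament_antisymmetric :
    forall x y, dominates x y -> dominates y x -> x = y;
  tournament_complete :
    forall x y, x <> y -> dominates x y \/ dominates y x }.

Definition isomorphic (V W : Type) (T : tournament V) (S : tournament W) :=
  exists f : V -> W, bijective f /\ forall x y, T x y <-> S (f x) (f y).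

Definition acyclic (V : Type) (T : tournament V) :=
  ~ exists x y z, [/\ T x y, T y z & T z x].

Section Induced.
Variables (V : Type) (T : tournament V) (A : set V).

Let dom (x y : A) : Prop := T (val x) (val y).

Fact induced_irreflexive x : ~ dom x x.
Proof. exact: tournament_irreflexive. Qed.

Fact induced_antisymmetric x y : dom x y -> dom y x -> x = y.
Proof. by move=> xy yx; apply: val_inj; apply: tournament_antisymmetric yx. Qed.

Fact induced_complete x y : x <> y -> dom x y \/ dom y x.
Proof.
by move=> xy; apply: tournament_complete => /val_inj /xy.
Qed.

Definition induced : tournament A :=
  Tournament induced_irreflexive induced_antisymmetric induced_complete.

End Induced.

Section LexicographicSum.
Variables (I : Type) (D : tournament I) (W : I -> Type).
Variable S : forall i, tournament (W i).

Inductive lexsum_dominates : {i : I & W i} -> {i : I & W i} -> Prop :=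
| Lexsum_within i (x y : W i) :
    S i x y -> lexsum_dominates (Tagged W x) (Tagged W y)
| Lexsum_across i j (x : W i) (y : W j) :
    D i j -> lexsum_dominates (Tagged W x) (Tagged W y).

Let inj_Tagged i (x y : W i) : Tagged W x = Tagged W y -> x = y.
Proof.
move=> e; have := projT2_eq e.
by rewrite (Prop_irrelevance (projT1_eq e) erefl).
Qed.

Let lexsum_inv u v : lexsum_dominates u v ->
  D (tag u) (tag v) \/
  exists i (x y : W i), [/\ u = Tagged W x, v = Tagged W y & S i x y].
Proof.
by case=> [i x y xy|i j x y ij]; [right; exists i, x, y | left].
Qed.

Fact lexsum_irreflexive u : ~ lexsum_dominates u u.
Proof.
case/lexsum_inv => [|[i [x [y [-> /inj_Tagged <-]]]]];
exact: tournament_irreflexive.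
Qed.

Fact lexsum_antisymmetric u v :
  lexsum_dominates u v -> lexsum_dominates v u -> u = v.
Proof.
have Dasym i j : D i j -> D j i -> False.
  move=> ij ji; have e := tournament_antisymmetric ij ji.
  by move: ij; rewrite e; apply: tournament_irreflexive.
move=> /lexsum_inv[uv|[i [x [y [-> -> xy]]]]] /lexsum_inv[vu|[j [z [t [ez et zt]]]]].
- by case: (Dasym _ _ uv vu).
- by case: (@tournament_irreflexive _ D j); move: uv; rewrite ez et.
- by case: (tournament_irreflexive vu).
- have ij : i = j by move: (congr1 (@tag I W) ez).
  case: _ / ij in z t ez et zt *.
  move: (inj_Tagged ez) (inj_Tagged et) => ? ?; subst z t.
  by rewrite (tournament_antisymmetric xy zt).
Qed.

Fact lexsum_complete u v :
  u <> v -> lexsum_dominates u v \/ lexsum_dominates v u.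
Proof.
case: u v => [i x] [j y] uv.
have [ij|ij] := pselect (i = j).
  case: _ / ij in y uv *.
  have xy : x <> y by move=> e; apply: uv; rewrite e.
  by have [] := tournament_complete (S i) xy => ?; [left|right]; left.
by have [] := tournament_complete D ij => ?; [left|right]; right.
Qed.

Definition lexsum : tournament {i : I & W i} :=
  Tournament lexsum_irreflexive lexsum_antisymmetric lexsum_complete.

End LexicographicSum.

Section Components.
Variables (V : Type) (T : tournament V).

Definition autonomous (A : set V) :=
  forall v, ~ A v ->
    (forall x, A x -> T v x) \/ (forall x, A x -> T x v).

Definition acyclic_component (x : V) : set V :=
  \bigcup_(A in [set A | [/\ autonomous A, acyclic (induced T A) & A x]]) A.

Definition infinite_acyclic_components : set (set V) :=
  [set C | infinite_set C /\ exists x, C = acyclic_component x].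

End Components.

Section Profile.
Variables (V : Type) (T : tournament V).

Definition iso_class (A : set V) : set (set V) :=
  [set B | isomorphic (induced T A) (induced T B)].

Definition iso_classes (n : nat) : set (set (set V)) :=
  [set iso_class A | A in [set A | A #= `I_n]].

(* [fset_set] is only meaningful on finite sets; see [finite_iso_classes]. *)
Definition profile (n : nat) : nat := #|` fset_set (iso_classes n)|.

Lemma finite_iso_classes n : finite_set (iso_classes n).
Proof.
pose class_of (M : {ffun 'I_n * 'I_n -> bool}) : set (set V) :=
  [set B : set V | exists e : 'I_n -> B,
     bijective e /\ forall i j, M (i, j) <-> induced T B (e i) (e j)].
apply: (@sub_finite_set _ _ (range class_of)); last first.
  exact: finite_image finite_finset.
move=> _ [A /= An <-].
have [f fbij] : exists f : 'I_n -> A, bijective f.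
  have /card_bijP[f fbij] : [set: 'I_n] #= A.
    by rewrite card_eq_sym -(card_eqr card_II).
  exists (f \o to_setT); apply: bij_comp fbij _.
  by exists val => // x; apply: val_inj.
exists [ffun p => `[< induced T A (f p.1) (f p.2) >]] => //.
have [g fK gK] := fbij.
apply/seteqP; split => B /=.
- move=> [e [ebij eM]]; exists (e \o g); split.
    exact: bij_comp ebij (Bijective gK fK).
  move=> x y; have := eM (g x) (g y); rewrite ffunE /= !gK => <-.
  by split => /asboolP.
- move=> [h [hbij hM]]; exists (h \o f); split; first exact: bij_comp.
  by move=> i j; rewrite ffunE /=; split => [/asboolP/hM|/hM/asboolP].
Qed.

End Profile.

Definition generating_series (V : Type) (T : tournament V) : nat -> int :=
  fun n => (profile T n)%:Z.

(* A formal power series over Z is the sequence of its coefficients. The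
   equality [H = P / Q] in Z[[x]], for [Q] with constant coefficient 1, is
   expressed as [Q * H = P] using the Cauchy product. *)
Definition series_mul (F G : nat -> int) : nat -> int :=
  fun n => \sum_(i < n.+1) F i * G (n - i)%N.

Definition is_fraction (H : nat -> int) (P Q : {poly int}) :=
  forall n, series_mul (fun i => Q`_i) H n = P`_n.

(* Main.v *)
Require Import Defs.
From mathcomp Require Import all_boot all_order all_algebra all_fingroup finmap.
From mathcomp Require Import all_classical all_reals all_analysis.
From mathcomp Require Import zify ring lra.
Set Implicit Arguments.
Unset Strict Implicit.
Unset Printing Implicit Defensive.
Import Order.TTheory GRing.Theory Num.Theory.
Import numFieldNormedType.Exports.
Local Open Scope classical_set_scope.
Local Open Scope ring_scope.

(* Let [pi] send a vertex to its summand. A finite subtournament [F] of [T] is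
   itself a lexicographic sum of acyclic tournaments, and choosing a
   presentation of [F] whose index set is as small as possible makes it unique:
   the index tournament [K] is a "reduced" subtournament of [D] (it has no
   nontrivial acyclic autonomous subset), and [F] is determined up to
   isomorphism by the multiplicities [w : K -> N] of the summands, up to partial
   automorphisms of [D]. Burnside's lemma for these partial automorphisms then
   writes the profile as a rational combination of numbers of multiplicity
   functions [w] of weight [n] fixed by a permutation [g]. A multiplicity
   exceeding the number of vertices in finite summands can be increased at
   will, so the realizable [w] fall into finitely many products of points and
   rays, with at most [k] rays; grouping the rays along the cycles of [g] gives
   generating series with denominators dividing (1-x)...(1-x^k). Hence
   [profile n / n^(k-1)] converges, and the limit is positive because some
   product with exactly [k] rays occurs. *)


(** * Series with denominator (1-x)...(1-x^k) *)

Section PolynomialAction.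
Variable A : comNzRingType.
Implicit Types (P Q : {poly A}) (f g : nat -> A).

(** The Cauchy product of [P] with the power series whose coefficients are [f]. *)
Definition smul P f (n : nat) : A := \sum_(i < n.+1) P`_i * f (n - i)%N.

(** The coefficient at [n] involves only finitely many terms of [f], so laws of the polynomial ring
    carry over to [smul]. *)
Lemma smul_coef P f n N : (n < N)%N -> smul P f n = (P * \poly_(i < N) f i)`_n.
Proof.
move=> nN; rewrite coefM; apply: eq_bigr => i _.
by rewrite coef_poly (leq_ltn_trans (leq_subr _ _) nN).
Qed.

Lemma smulM P Q f n : smul (P * Q) f n = smul P (smul Q f) n.
Proof.
rewrite (@smul_coef _ _ _ n.+1) // -mulrA coefM; apply: eq_bigr => i _.
by rewrite (@smul_coef _ _ _ n.+1) // ltnS leq_subr.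
Qed.

Lemma eq_smul P f g : f =1 g -> smul P f =1 smul P g.
Proof. by move=> fg n; apply: eq_bigr => i _; rewrite fg. Qed.

Lemma smulD P f g n : smul P (fun n => f n + g n) n = smul P f n + smul P g n.
Proof. by rewrite -big_split; apply: eq_bigr => i _; rewrite mulrDr. Qed.

Lemma smulZ P a f n : smul P (fun n => a * f n) n = a * smul P f n.
Proof. by rewrite mulr_sumr; apply: eq_bigr => i _; rewrite mulrCA. Qed.

Lemma smul1 f n : smul 1 f n = f n.
Proof.
rewrite /smul big_ord_recl coef1 mul1r subn0 big1 ?addr0 // => i _.
by rewrite coef1 mul0r.
Qed.

Lemma smul_1subXn l f n : (0 < l)%N ->
  smul (1 - 'X^l) f n = f n - (if (l <= n)%N then f (n - l)%N else 0).
Proof.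
move=> l0; rewrite (@smul_coef _ _ _ n.+1) // mulrBl mul1r coefB coefXnM.
rewrite !coef_poly ltnSn; congr (_ - _).
by case: leqP => // ln; rewrite ltnS leq_subr.
Qed.

Definition eventually0 f := exists N, forall n, (N <= n)%N -> f n = 0.

Lemma eventually0_smul P f : eventually0 f -> eventually0 (smul P f).
Proof.
case=> N f0; exists (N + size P)%N => n Nn; apply: big1 => i _.
have [iP|iP] := ltnP i (size P); last by rewrite nth_default // mul0r.
by rewrite f0 ?mulr0 //; lia.
Qed.

Definition qfact k : {poly A} := \prod_(1 <= i < k.+1) (1 - 'X^i).

(* Among [l] consecutive exponents [m+1, .., m+l] one is a multiple of [l]. *)
Lemma qfact_dvd m l : (0 < l)%N ->
  exists P, qfact (m + l) = P * qfact m * (1 - 'X^l).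
Proof.
move=> l0; pose j := ((m + l) %/ l * l)%N.
have jml : (j <= m + l)%N by rewrite /j leq_divM.
have mj : (m < j)%N.
  by rewrite /j divnDr ?dvdnn // divnn l0; move: (divn_eq m l) (ltn_pmod m l0); lia.
have [P EP] : exists P : {poly A}, 1 - 'X^j = P * (1 - 'X^l).
  rewrite /j mulnC exprM -{1}(expr1n {poly A} ((m + l) %/ l)) subrXX mulrC.
  by eexists.
rewrite /qfact (@big_cat_nat _ _ _ m.+1) //=; last by lia.
rewrite [X in _ * X](@big_cat_nat _ _ _ j) //=; last by lia.
rewrite [X in _ * (_ * X)]big_ltn; last by lia.
rewrite EP.
set a := \prod_(1 <= i < _) _; set b := \prod_(m.+1 <= i < _) _.
set c := \prod_(j.+1 <= i < _) _.
by exists (b * c * P); ring.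
Qed.

(** The series with coefficients [f] is a fraction with denominator [qfact k]: multiplying by the
    denominator leaves a polynomial. *)
Definition ratl k f := eventually0 (smul (qfact k) f).

Lemma ratl_ext k f g : f =1 g -> ratl k f -> ratl k g.
Proof. by move=> fg [N H]; exists N => n /H <-; apply: eq_smul. Qed.

Lemma ratlD k f g : ratl k f -> ratl k g -> ratl k (fun n => f n + g n).
Proof.
move=> [N H] [N' H']; exists (maxn N N') => n; rewrite geq_max => /andP[a b].
by rewrite smulD H // H' // addr0.
Qed.

Lemma ratlZ k a f : ratl k f -> ratl k (fun n => a * f n).
Proof. by move=> [N H]; exists N => n /H E; rewrite smulZ E mulr0. Qed.

Lemma ratl0 k : ratl k (fun=> 0).
Proof. by exists 0%N => n _; apply: big1 => i _; rewrite mulr0. Qed.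

Lemma ratl_sum k (J : Type) (r : seq J) (F : J -> nat -> A) :
  (forall j, ratl k (F j)) -> ratl k (fun n => \sum_(j <- r) F j n).
Proof.
move=> H; elim: r => [|j r IH].
  by apply: ratl_ext (ratl0 k) => n; rewrite big_nil.
by apply: ratl_ext (ratlD (H j) IH) => n; rewrite big_cons.
Qed.

(** By [qfact_dvd], a further factor [1 - 'X^l] raises the index by [l]; the lengths of cycles will
    thus add up. *)
Lemma ratl_1subXn m l f : (0 < l)%N ->
  ratl m (smul (1 - 'X^l) f) -> ratl (m + l) f.
Proof.
move=> l0 H; have [P E] := qfact_dvd m l0.
have [N H'] := eventually0_smul P H.
by exists N => n /H' <-; rewrite E smulM -[RHS]smulM.
Qed.

Lemma ratl_leq m k f : (m <= k)%N -> ratl m f -> ratl k f.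
Proof.
move=> /subnKC <-; elim: (k - m)%N => [|j IH] H; first by rewrite addn0.
rewrite addnS -addn1; apply: ratl_1subXn => //.
have [N H'] := eventually0_smul (1 - 'X^1) (IH H).
by exists N => n /H'; rewrite -!smulM mulrC.
Qed.

Lemma ratlS k f : ratl k.+1 f -> ratl k (smul (1 - 'X^(k.+1)) f).
Proof. by case=> N H; exists N => n /H; rewrite /qfact big_nat_recr //= smulM. Qed.

End PolynomialAction.

(** * Growth of sequences with a rational generating series *)

Section Asymptotics.
Variable R : realType.
Implicit Types f g h : R^nat.

(** The difference of powers factors as [m] times a sum of [k.+1] terms, and each term divided by
    [n ^ k] is a power of [(n - m) / n], which tends to 1. *)
Lemma subr_expn_cvg m k :
  (fun n : nat => ((n%:R : R) ^+ k.+1 - (n - m)%N%:R ^+ k.+1) / n%:R ^+ k)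
    @ \oo --> (m%:R * k.+1%:R : R).
Proof.
have ratio : (fun n : nat => (n - m)%N%:R / n%:R : R) @ \oo --> (1 : R).
  have : (fun n : nat => 1 - m%:R * (n.+1%:R : R)^-1) @ \oo --> (1 - m%:R * 0 : R).
    by apply: cvgB; [exact: cvg_cst|apply: cvgM; [exact: cvg_cst|exact: cvg_harmonic]].
  rewrite mulr0 subr0 => H; rewrite -cvg_shiftS.
  apply: cvg_trans H; apply: near_eq_cvg; near=> n => /=.
  have mn : (m <= n.+1)%N by near: n; exists m => // n /=; lia.
  by rewrite natrB // mulrBl divff // pnatr_eq0.
have : (fun n : nat => \sum_(i < k.+1) m%:R * ((n - m)%N%:R / n%:R : R) ^+ i) @ \oo
   --> (\sum_(i < k.+1) m%:R * 1 ^+ i : R).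
  apply: cvg_big => [|i _]; first exact: add_continuous.
  apply: cvgM; first exact: cvg_cst.
  elim: (nat_of_ord i) => [|j IH]; first by rewrite expr0; exact: cvg_cst.
  under eq_fun do rewrite exprS.
  by rewrite exprS; exact: cvgM.
have -> : \sum_(i < k.+1) m%:R * 1 ^+ i = m%:R * k.+1%:R :> R.
  rewrite (eq_bigr (fun=> m%:R)) => [|i _]; last by rewrite expr1n mulr1.
  by rewrite big_const_ord iter_addr addr0 mulr_natr.
apply: cvg_trans; apply: near_eq_cvg; near=> n => /=.
have mn : (m <= n)%N by near: n; exists m.
have n0 : (n%:R : R) != 0 by rewrite pnatr_eq0; near: n; exists 1%N => // n /=; lia.
rewrite subrXX -natrB ?leq_subr // subKn // -mulrA; rewrite mulr_suml mulr_sumr.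
apply: eq_bigr => i _; congr (_ * _).
have ik : (i <= k)%N by rewrite -ltnS.
have -> : (n%:R : R) ^+ k = n%:R ^+ (k - i) * n%:R ^+ i by rewrite -exprD subnK.
rewrite /= expr_div_n.
field; by rewrite !expf_eq0 !negb_and n0 !orbT.
Unshelve. all: by end_near. Qed.

Lemma telescoping_bound (m k N : nat) (e : R) h : (0 < m)%N -> 0 <= e ->
  (forall n, (N + m <= n)%N -> `|h n - h (n - m)%N| <= e * n%:R ^+ k) ->
  exists C, forall n, `|h n| <= C + e * n%:R ^+ k.+1.
Proof.
move=> m0 e0 H; pose C := \sum_(i < N + m) `|h i|.
exists C => n; elim/ltn_ind: n => n IH.
have [nN|nN] := ltnP n (N + m).
  rewrite ler_wpDr ?mulr_ge0 ?exprn_ge0 // /C (bigD1 (Ordinal nN)) //= lerDl.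
  by apply: sumr_ge0.
have nm : (n - m < n)%N by lia.
rewrite -(subrK (h (n - m)%N) (h n)) (le_trans (ler_normD _ _)) //.
apply: le_trans (lerD (H _ nN) (IH _ nm)) _.
rewrite addrCA lerD2l -mulrDr ler_wpM2l //.
(* As [0 < m], [n - m] is at most [n.-1], so the second summand dominates [(n - m) ^ k.+1] and the
   first one pays for the increment. *)
have -> : (n%:R : R) ^+ k.+1 = n%:R ^+ k + n.-1%:R * n%:R ^+ k.
  by rewrite exprS -{1}(@prednK n) ?mulrS ?mulrDl ?mul1r //; lia.
rewrite lerD2l exprS ler_pM ?exprn_ge0 ?ler_nat //; first by lia.
by rewrite lerXn2r ?nnegrE // ler_nat leq_subr.
Qed.

Lemma telescoping_cvg0 (m k : nat) h : (0 < m)%N ->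
  (fun n : nat => (h n - h (n - m)%N) / n%:R ^+ k) @ \oo --> (0 : R) ->
  (fun n : nat => h n / n%:R ^+ k.+1) @ \oo --> (0 : R).
Proof.
move=> m0 /cvgr0Pnorm_le H; apply/cvgr0Pnorm_le => e e0.
(* Half of [e] bounds the increments; the other half absorbs the constant [C] for large [n]. *)
have e20 : 0 < e / 2 by rewrite divr_gt0.
have [N _ HN] := H _ e20.
have [|C HC] := @telescoping_bound m k N.+1 (e / 2) h m0 (ltW e20).
  move=> n Nn; have /= := HN n ltac:(rewrite /=; lia).
  have n0 : 0 < (n%:R : R) ^+ k by rewrite exprn_gt0 // ltr0n; lia.
  by rewrite normrM normfV (gtr0_norm n0) ler_pdivrMr.
near=> n.
have n1 : (0 < n)%N by near: n; exists 1%N.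
have n0 : 0 < (n%:R : R) ^+ k.+1 by rewrite exprn_gt0 // ltr0n.
rewrite normrM normfV (gtr0_norm n0) ler_pdivrMr //.
apply: le_trans (HC n) _; rewrite -lerBrDr -mulrBl.
have -> : e - e / 2 = e / 2 by lra.
rewrite mulrC -ler_pdivrMr //; apply: (@le_trans _ _ n%:R).
  near: n; exact: nbhs_infty_ger.
rewrite exprS ler_peMr // exprn_ege1 // ler1n //.
Unshelve. all: by end_near. Qed.

(** Induction on [k]. If [k = 0], [f] is eventually constant. Otherwise the differences of [f] at
    distance [k + 1] are handled by induction and have a limit [b] after scaling; [a] is chosen so
    that subtracting [a n ^ k] makes these differences negligible, and they are summed by
    [telescoping_cvg0]. *)
Lemma ratl_cvg k f : ratl k.+1 f ->
  exists a, (fun n : nat => f n / n%:R ^+ k) @ \oo --> (a : R).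
Proof.
elim: k f => [|k IH] f Hf.
  have [N HN] := Hf.
  have E n : f (N + n)%N = f N.
    elim: n => [|n En]; first by rewrite addn0.
    rewrite -En addnS; apply/eqP; rewrite -subr_eq0.
    have := HN (N + n).+1 ltac:(lia).
    by rewrite /qfact big_nat1 smul_1subXn //= subn1 => ->.
  exists (f N); rewrite -(cvg_shiftn N); under eq_fun do rewrite addnC E expr0 divr1.
  exact: cvg_cst.
have [b Hb] := IH _ (ratlS Hf).
pose m := k.+2; pose a : R := b / (m%:R * k.+1%:R).
exists a; pose h n := f n - a * n%:R ^+ k.+1.
suff H0 : (fun n : nat => h n / n%:R ^+ k.+1) @ \oo --> (0 : R).
  have := cvgD H0 (@cvg_cst _ a _ \oo _); rewrite add0r => /(_ _ _) H1.
  apply: cvg_trans H1; apply: near_eq_cvg; near=> n => /=.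
  rewrite /h fctE; field.
  by rewrite expf_eq0 /= pnatr_eq0 -lt0n; near: n; exists 1%N.
apply: (@telescoping_cvg0 m) => //.
have := cvgB Hb (cvgM (@cvg_cst _ a _ \oo _) (@subr_expn_cvg m k)).
have -> : b - a * (m%:R * k.+1%:R) = 0.
  by rewrite /a divfK ?subrr // mulf_neq0 // pnatr_eq0.
move=> /(_ _ _ _) H1; apply: cvg_trans H1; apply: near_eq_cvg; near=> n => /=.
rewrite !fctE smul_1subXn //.
have -> : (k.+2 <= n)%N by near: n; exists k.+2.
transitivity ((f n - f (n - m)%N) / n%:R ^+ k -
    a * ((n%:R ^+ k.+1 - (n - m)%N%:R ^+ k.+1) / n%:R ^+ k)); first by [].
by rewrite /h; ring.
Unshelve. all: by end_near. Qed.

End Asymptotics.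
(** * Multiplicity functions invariant under a permutation *)

Section WeightFunctions.
Local Open Scope nat_scope.
Variable I : finType.
Implicit Types (u v w : {ffun I -> nat}) (s : {perm I}) (Z K : {set I}).

Lemma mem_fset_filter (X : choiceType) (A : {fset X}) (P : pred X) x :
  (x \in [fset y in A | P y]%fset) = (x \in A) && P x.
Proof. by rewrite !inE. Qed.

Definition weight w : nat := (\sum_q w q)%N.

(** A function of weight [n] has values at most [n], which makes the set finite. *)
Definition compositions n : {fset {ffun I -> nat}} :=
  [fset w in [fset [ffun q => val (x q)] | x : {ffun I -> 'I_n.+1} in predT]
   | weight w == n]%fset.

Lemma mem_compositions n w : (w \in compositions n) = (weight w == n).
Proof.
rewrite !inE /= andb_idl // => /eqP wn; apply/imfsetP.
exists [ffun q => inord (w q)] => //=; apply/ffunP => q.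
by rewrite !ffunE inordK // ltnS -wn /weight (bigD1 q) //= leq_addr.
Qed.

Definition invariant_under s w := [forall q, w (s q) == w q].

(** Membership in a product of rays, starting at [v] in the directions of [Z], and of points in the
    others. *)
Definition grows_on Z v w :=
  [forall q, if q \in Z then (v q <= w q)%N else w q == v q].

Definition growths s Z v n :=
  [fset w in compositions n | invariant_under s w && grows_on Z v w]%fset.

Lemma mem_growths s Z v n w : (w \in growths s Z v n) =
  [&& weight w == n, invariant_under s w & grows_on Z v w].
Proof. by rewrite mem_fset_filter mem_compositions. Qed.

Lemma invariant_underX s w : invariant_under s w ->
  forall i q, w ((s ^+ i)%g q) = w q.
Proof.
move=> /forallP H; elim=> [|i IH] q; first by rewrite expg0 perm1.
by rewrite expgSr permM (eqP (H _)) IH.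
Qed.

Lemma invariant_under_porbit s w z q : invariant_under s w ->
  q \in porbit s z -> w q = w z.
Proof. by move=> H /porbitP[i ->]; rewrite invariant_underX. Qed.

Lemma porbit_stable s Z z q : z \in Z -> (forall q, (s q \in Z) = (q \in Z)) ->
  q \in porbit s z -> q \in Z.
Proof.
move=> zZ sZ /porbitP[i ->]; elim: i => [|i IH]; first by rewrite expg0 perm1.
by rewrite expgSr permM sZ.
Qed.

Lemma mem_porbit_perm s z q : (s q \in porbit s z) = (q \in porbit s z).
Proof.
rewrite -!eq_porbit_mem; congr (_ == _).
by have := porbit_perm s 1 q; rewrite expg1.
Qed.

Section Step.
Variables (s : {perm I}) (Z : {set I}) (v : {ffun I -> nat}) (z : I).
Hypotheses (zZ : z \in Z) (sZ : forall q, (s q \in Z) = (q \in Z)).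
Hypothesis sv : invariant_under s v.
Let c := porbit s z.

Let cZ q : q \in c -> q \in Z.
Proof. exact: porbit_stable. Qed.

Let sc q : (s q \in c) = (q \in c).
Proof. exact: mem_porbit_perm. Qed.

Let shift w : {ffun I -> nat} := [ffun q => (w q + (q \in c))%N].

Let weight_shift w : weight (shift w) = (weight w + #|c|)%N.
Proof.
rewrite /weight (eq_bigr (fun q => w q + (q \in c))%N) => [|q _]; last first.
  by rewrite ffunE.
by rewrite big_split /= -big_mkcond /= sum1_card.
Qed.

Let shift_inj : injective shift.
Proof.
move=> w w' /ffunP E; apply/ffunP => q; have := E q.
by rewrite !ffunE => /addIn.
Qed.

(** By invariance, [w] and [v] are constant on the cycle [c]. If [w z] exceeds [v z], subtracting
    one all over [c] is a bijection onto the functions of weight [n - #|c|]; otherwise [w] equals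
    [v] on [c], which can leave [Z]. *)
Lemma growths_step n : #|` growths s Z v n| =
  ((if (#|c| <= n)%N then #|` growths s Z v (n - #|c|)| else 0) +
   #|` growths s (Z :\: c) v n|)%N.
Proof.
have -> : growths s Z v n =
    ([fset w in growths s Z v n | v z < w z] `|` growths s (Z :\: c) v n)%fset.
  apply/fsetP => w; rewrite ?in_fsetI ?in_fsetU !(mem_growths, mem_fset_filter).
  case: eqP => //= wn; case: (boolP (invariant_under s w)) => //= sw.
  apply/idP/idP.
    move=> /forallP g; rewrite /grows_on.
    have [wz|wz] := leqP (w z) (v z); last first.
      by apply/orP; left; apply/andP; split; [exact/forallP|].
    apply/orP; right; apply/forallP => q; have := g q; rewrite inE.
    case: (boolP (q \in c)) => //= qc; rewrite (cZ qc) => _.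
    have := g z; rewrite zZ (invariant_under_porbit sw qc).
    by rewrite (invariant_under_porbit sv qc) eqn_leq wz.
  case/orP => [/andP[]//|/forallP g]; apply/forallP => q; have := g q.
  rewrite inE; case: (boolP (q \in c)) => //= qc /eqP ->.
  by rewrite (cZ qc).
rewrite cardfsU [X in (_ - X)%N](_ : _ = 0%N) ?subn0; last first.
  apply/eqP; rewrite cardfs_eq0; apply/eqP/fsetP => w.
  rewrite ?in_fsetI ?in_fsetU !(mem_growths, mem_fset_filter).
  apply/negP => /andP[/andP[_ lt]].
  move=> /and3P[_ _ /forallP/(_ z)]; rewrite inE porbit_id /= => /eqP E.
  by rewrite E ltnn in lt.
congr (_ + _)%N; case: leqP => cn.
  have <- : #|` [fset shift x | x in growths s Z v (n - #|c|)]%fset| =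
      #|` growths s Z v (n - #|c|)| by apply: card_imfset.
  congr #|` _|.
  apply/fsetP => w; rewrite mem_fset_filter; apply/idP/imfsetP => /=.
    move=> /andP[]; rewrite mem_growths => /and3P[wn sw /forallP g] lt.
    have wE : w = shift [ffun q => (w q - (q \in c))%N].
      apply/ffunP => q; rewrite !ffunE.
      case: (boolP (q \in c)) => /= qc; last by rewrite subn0 addn0.
      by rewrite subn1 addn1 prednK // (invariant_under_porbit sw qc) (leq_trans _ lt).
    exists [ffun q => (w q - (q \in c))%N] => //.
    rewrite mem_growths; apply/and3P; split.
    - by move: wn; rewrite {1}wE weight_shift => /eqP <-; rewrite addnK.
    - by apply/forallP => q; rewrite !ffunE sc (eqP (forallP sw q)).
    - apply/forallP => q; rewrite !ffunE; have := g q.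
      case: (boolP (q \in c)) => /= qc; last by rewrite subn0.
      rewrite (cZ qc) (invariant_under_porbit sw qc).
      by rewrite (invariant_under_porbit sv qc); move: lt; lia.
  move=> [x]; rewrite mem_growths => /and3P[/eqP xn sx /forallP g] ->.
  rewrite mem_growths weight_shift xn subnK // eqxx /=.
  apply/andP; split; [apply/andP; split|].
  - by apply/forallP => q; rewrite !ffunE sc (eqP (forallP sx q)).
  - apply/forallP => q; rewrite !ffunE; have := g q.
    case: (boolP (q \in c)) => /= qc; last by rewrite addn0.
    by rewrite (cZ qc); lia.
  - by have := g z; rewrite zZ ffunE porbit_id addn1 ltnS.
(* A function exceeding [v] at [z] is positive on all of [c], so its weight is at least [#|c|]. *)
apply/eqP; rewrite cardfs_eq0; apply/eqP/fsetP => w.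
rewrite !(mem_growths, mem_fset_filter).
apply/negP => /andP[/and3P[/eqP wn sw g] lt].
move: cn; rewrite -wn ltnNge => /negP; apply.
rewrite /weight (bigID [in c]) /= -sum1_card.
apply: leq_trans (leq_addr _ _); apply: leq_sum => q qc.
rewrite (invariant_under_porbit sw qc).
exact: leq_ltn_trans lt.
Qed.

End Step.

(* Subtracting one on a whole cycle of [s] contained in [Z] lowers the weight
   by the length of the cycle; cycles are then removed from [Z] one by one. *)
Lemma ratl_growths (A : comNzRingType) s Z v :
  (forall q, (s q \in Z) = (q \in Z)) -> invariant_under s v ->
  ratl #|Z| (fun n => #|` growths s Z v n|%:R : A)%R.
Proof.
move=> sZ sv; move: {2}_.+1 (ltnSn #|Z|) sZ => N.
elim: N => // N IH in Z *; rewrite ltnS => ZN sZ.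
have [->|[z zZ]] := set_0Vmem Z.
  (* When [Z] is empty only [v] itself remains, and the count vanishes past its weight. *)
  exists (weight v).+1 => n vn; rewrite cards0 /qfact big_geq // smul1.
  suff -> : growths s finset.set0 v n = fset0 by rewrite cardfs0.
  apply/fsetP => w; rewrite mem_growths inE; apply/negP.
  move=> /and3P[/eqP wn _ /forallP g]; move: vn; rewrite -wn /weight.
  apply/negP; rewrite -leqNgt; apply/eq_leq/eq_bigr => q _; have := g q.
  by rewrite finset.in_set0 => /eqP.
have cardZ : (#|Z :\: porbit s z| + #|porbit s z| = #|Z|)%N.
  have /finset.setIidPr E : porbit s z \subset Z.
    by apply/fintype.subsetP => q; apply: porbit_stable.
  by rewrite addnC -(cardsID (porbit s z) Z) E.
have c0 : (0 < #|porbit s z|)%N by apply/card_gt0P; exists z; exact: porbit_id.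
rewrite -cardZ; apply: ratl_1subXn => //.
have := IH (Z :\: porbit s z); case=> [||M HM].
- by move: ZN; rewrite -cardZ; lia.
- by move=> q; rewrite !inE mem_porbit_perm sZ.
exists M => n /HM <-; apply: eq_smul => j; rewrite smul_1subXn //.
rewrite (growths_step zZ sZ sv) natrD; case: ifP => _.
  by rewrite addrAC subrr add0r.
by rewrite add0r subr0.
Qed.

End WeightFunctions.

Arguments compositions {I} n.
(** The terms of one fibre of [f] are all the inverse of its size, so each fibre contributes 1. *)
Lemma card_imfset_inv (F : numFieldType) (X Y : choiceType) (f : X -> Y) (A : {fset X}) :
  #|` [fset f x | x in A]%fset|%:R =
  \sum_(x <- A) (#|` [fset y in A | f y == f x]%fset|%:R)^-1 :> F.
Proof.
rewrite (partition_big_imfset _ f) /= card_fset_sum1 natr_sum.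
rewrite big_seq [RHS]big_seq; apply: eq_bigr => _ /imfsetP[x /= xA ->].
pose c : F := #|` [fset y in A | f y == f x]%fset|%:R.
rewrite (eq_bigr (fun=> c^-1)) => [|y /eqP -> //].
have cE : #|` [fset y in A | f y == f x]%fset| = count (fun y => f y == f x) A.
  rewrite -size_filter; apply/perm_size/uniq_perm; rewrite ?fset_uniq ?filter_uniq //.
  by move=> y; rewrite mem_fset_filter mem_filter andbC.
rewrite big_const_seq iter_addr addr0 -cE -[RHS]mulr_natl -/c divff //.
by rewrite pnatr_eq0 cE -lt0n -has_count; apply/hasP; exists x.
Qed.

(** * Presentations of finite tournaments *)

Section Types.
Local Open Scope nat_scope.
Variables (V : choiceType) (I : finType) (t : rel V) (d : rel I).
Hypothesis t_irr : irreflexive t.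
Hypothesis t_asym : forall x y, x != y -> t x y = ~~ t y x.
Hypothesis d_irr : irreflexive d.
Hypothesis d_asym : forall x y, x != y -> d x y = ~~ d y x.
Implicit Types (s : seq V) (p : V -> I) (K : {set I}) (w : {ffun I -> nat}).

Definition acyclic_on (X : Type) (r : rel X) (A : X -> Prop) :=
  forall x y z, A x -> A y -> A z -> r x y -> r y z -> ~~ r z x.

(* [p] presents the tournament induced on [s] as a lexicographic sum, indexed
   by the image of [p], of acyclic tournaments. *)
Definition presents s p :=
  {in s &, forall x y, p x != p y -> t x y = d (p x) (p y)} /\
  forall q, acyclic_on t (fun x => x \in s /\ p x = q).

Definition multiplicity s p : {ffun I -> nat} :=
  [ffun q => count (fun x => p x == q) s].

Definition msupport w : {set I} := [set q | w q != 0]%SET.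

(** Autonomy inside [K] is expressed by constancy of [d v] on [B]; in a tournament the arcs in the
    other direction follow. *)
Definition reduced K := forall B : {set I}, B \subset K ->
  (forall v, v \in K -> v \notin B -> {in B &, forall b b', d v b = d v b'}) ->
  acyclic_on d (fun b => b \in B) -> {in B &, forall b b', b = b'}.

Lemma mem_msupport_multiplicity s p q :
  reflect (exists2 x, x \in s & p x = q) (q \in msupport (multiplicity s p)).
Proof.
rewrite inE ffunE -lt0n -has_count.
by apply: (iffP hasP) => [[x xs /eqP]|[x xs /eqP]]; exists x.
Qed.

Lemma msupport_multiplicity s p x : x \in s -> p x \in msupport (multiplicity s p).
Proof. by move=> xs; apply/mem_msupport_multiplicity; exists x. Qed.

Lemma weight_multiplicity s p : weight (multiplicity s p) = size s.
Proof.
rewrite /weight (eq_bigr (fun q => \sum_(x <- s | p x == q) 1)) => [|q _]; last first.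
  by rewrite ffunE sum1_count.
rewrite (exchange_big_dep predT) //= -sum1_size; apply: eq_bigr => x _.
by rewrite (big_pred1 (p x)) // => q; rewrite eq_sym.
Qed.

Lemma t_asymF x y : t x y -> t y x = false.
Proof.
move=> xy; apply/negbTE; rewrite -t_asym //.
by apply: contraTneq xy => ->; rewrite t_irr.
Qed.

(** A 3-cycle lies in one fibre, or maps to a 3-cycle, or has exactly two vertices in one fibre; in
    the last case the arc between the two indices would go both ways. *)
Lemma acyclic_on_preimage (A : V -> Prop) p :
  (forall x y, A x -> A y -> p x != p y -> t x y = d (p x) (p y)) ->
  (forall q, acyclic_on t (fun x => A x /\ p x = q)) ->
  acyclic_on d (fun q => exists x, A x /\ p x = q) -> acyclic_on t A.
Proof.
move=> cross fib acyc x y z Ax Ay Az.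
have [exy|xy] := eqVneq (p x) (p y).
  have [eyz|yz] := eqVneq (p y) (p z).
    by apply: (fib (p x)); split=> //; rewrite exy.
  rewrite [t y z]cross // [t z x]cross // exy 1?eq_sym // => _ dyz.
  by rewrite -d_asym.
have [eyz|yz] := eqVneq (p y) (p z).
  rewrite cross // [t z x]cross // -eyz 1?eq_sym // => dxy _.
  by rewrite -d_asym.
have [ezx|zx] := eqVneq (p z) (p x).
  rewrite cross // [t y z]cross // ezx => dxy.
  by rewrite d_asym 1?eq_sym // dxy.
by rewrite !cross //; apply: acyc; [exists x|exists y|exists z].
Qed.

(* The image of an acyclic autonomous set under a presentation is acyclic and
   autonomous, hence a singleton when the index tournament is reduced. *)
Lemma presents_constant s p (A : V -> Prop) :
  presents s p -> reduced (msupport (multiplicity s p)) ->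
  (forall v, v \in s -> ~ A v ->
     forall a a', a \in s -> a' \in s -> A a -> A a' -> t v a = t v a') ->
  acyclic_on t (fun x => x \in s /\ A x) ->
  forall x y, x \in s -> y \in s -> A x -> A y -> p x = p y.
Proof.
move=> [cross _] red aut acyc x y xs ys Ax Ay.
pose B := [set q | `[< exists a, [/\ a \in s, A a & p a = q] >]]%SET.
have BP q : reflect (exists a, [/\ a \in s, A a & p a = q]) (q \in B).
  by rewrite inE; apply: (iffP (asboolP _)).
apply: (red B); last 2 first.
- by apply/BP; exists x.
- by apply/BP; exists y.
- by apply/fintype.subsetP => q /BP[a [sa _ <-]]; apply: msupport_multiplicity.
- move=> q /mem_msupport_multiplicity[v vs <-] vB b b' /BP[a [sa Aa <-]].
  move=> /BP[a' [sa' Aa' <-]].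
  have ne u : u \in s -> A u -> p v != p u.
    by move=> us Au; apply: contra vB => /eqP e; apply/BP; exists u.
  rewrite -!cross ?ne //; apply: aut => // Av.
  by move/BP: vB; apply; exists v.
- move=> _ _ _ /BP[a [sa Aa <-]] /BP[b [sb Ab <-]] /BP[c [sc Ac <-]].
  have [->|ab] := eqVneq (p a) (p b); first by rewrite d_irr.
  have [->|bc] := eqVneq (p b) (p c); first by rewrite d_irr.
  have [->|ca] := eqVneq (p c) (p a); first by rewrite d_irr.
  by rewrite -!cross //; apply: acyc.
Qed.

(** The fibres of [p] are acyclic and autonomous in [s], so [presents_constant] applies to them. *)
Lemma presents_fibre s p p' : presents s p -> presents s p' ->
  reduced (msupport (multiplicity s p')) ->
  {in s &, forall x y, p x = p y -> p' x = p' y}.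
Proof.
move=> [cross acyc] P' red x y xs ys e.
apply: (presents_constant P' red (A := fun z => p z = p x)) => //.
  move=> v vs /eqP ne a a' sa sa' ea ea'.
  by rewrite !cross ?ea ?ea' //.
Qed.

Lemma extend_to_perm (l : seq I) (f : I -> I) : {in l &, injective f} ->
  exists g : {perm I}, {in l, g =1 f}.
Proof.
elim: l => [|a l IH] f_inj; first by exists 1%g.
have [|g Hg] := IH; first by move=> x y xl yl; apply: f_inj; rewrite inE ?xl ?yl orbT.
have [al|al] := boolP (a \in l).
  by exists g => x; rewrite inE => /predU1P[->|]; apply: Hg.
(* The transposition corrects the value at [a]; by injectivity of [f] it moves no earlier value. *)
exists (g * tperm (g a) (f a))%g => x; rewrite inE permM => /predU1P[->|xl].
  exact: tpermL.
have xa : x != a by apply: contraNneq al => <-.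
rewrite tpermD; first exact: Hg.
  by rewrite (inj_eq (@perm_inj _ g)) eq_sym.
rewrite Hg //; apply: contra_neq xa => e.
by apply: f_inj; rewrite ?inE ?eqxx ?xl ?orbT.
Qed.

(** A partial automorphism of [d] with domain [K], represented by a permutation of all of [I] so
    that composition and inversion take place in a group. *)
Definition embeds_on (g : {perm I}) K :=
  [forall a in K, forall b in K, d (g a) (g b) == d a b].

(** By [presents_fibre] in both directions the two presentations have the same fibres, hence their
    indices correspond bijectively. *)
Lemma presents_unique s p p' : presents s p -> presents s p' ->
  reduced (msupport (multiplicity s p)) -> reduced (msupport (multiplicity s p')) ->
  exists2 g : {perm I}, embeds_on g (msupport (multiplicity s p)) &
    {in s, forall x, p' x = g (p x)}.
Proof.
move=> P P' red red'.
have fib := presents_fibre P P' red'; have fib' := presents_fibre P' P red.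
have [s0|[x0 x0s]] : s = [::] \/ exists x, x \in s.
  by case: (s) => [|x l]; [left|right; exists x; rewrite inE eqxx].
  exists 1%g; last by rewrite s0.
  by apply/forall_inP => a _; apply/forall_inP => b _; rewrite !perm1.
pose rep q := nth x0 s (find (fun x => p x == q) s).
have repP x : x \in s -> rep (p x) \in s /\ p (rep (p x)) = p x.
  move=> xs; have H : has (fun y => p y == p x) s by apply/hasP; exists x.
  by split; [apply: mem_nth; rewrite -has_find|apply/eqP; exact: (nth_find x0 H)].
have [|g Hg] := @extend_to_perm (map p s) (p' \o rep).
  move=> _ _ /mapP[x xs ->] /mapP[y ys ->] /= e.
  have [[rx <-] [ry <-]] := (repP x xs, repP y ys); exact: fib'.
have gp x : x \in s -> p' x = g (p x).
  move=> xs; rewrite Hg ?map_f //=; have [rx ex] := repP x xs.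
  exact: fib.
exists g => //; apply/forall_inP => a /mem_msupport_multiplicity[x xs <-].
apply/forall_inP => b /mem_msupport_multiplicity[y ys <-]; rewrite -!gp //.
have [e|ne] := eqVneq (p x) (p y); first by rewrite -(fib _ _ xs ys e) e !d_irr.
have ne' : p' x != p' y by apply: contra_neq ne; apply: fib'.
by rewrite -P.1 // -P'.1.
Qed.

Definition relabel w (g : {perm I}) : {ffun I -> nat} := [ffun q => w ((g^-1)%g q)].

Lemma presents_relabel s p (g : {perm I}) : presents s p ->
  embeds_on g (msupport (multiplicity s p)) ->
  presents s (g \o p) /\ multiplicity s (g \o p) = relabel (multiplicity s p) g.
Proof.
move=> [cross acyc] /forall_inP emb; split; [split|].
- move=> x y xs ys /=; rewrite (inj_eq perm_inj) => ne.
  have /forall_inP H := emb _ (msupport_multiplicity p xs).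
  by rewrite (eqP (H _ (msupport_multiplicity p ys))) cross.
- move=> q x y z [xs <-] [ys /perm_inj ey] [zs /perm_inj ez].
  exact: (acyc (p x)).
- apply/ffunP => q; rewrite !ffunE; apply: eq_count => x /=.
  by rewrite -(inj_eq (@perm_inj _ (g^-1)%g)) permK.
Qed.

(** An acyclic autonomous [B] with two points [b] and [b'] violates reducedness; collapsing [B] to
    [b] removes [b'] from the support, and one repeats. *)
Lemma exists_reduced s (p0 : V -> I) : presents s p0 ->
  exists2 p, presents s p & reduced (msupport (multiplicity s p)).
Proof.
move: {2}_.+1 (ltnSn #|msupport (multiplicity s p0)|) => N.
elim: N p0 => // N IH p0; rewrite ltnS => leN P0.
have [|/existsNP[B]] := pselect (reduced (msupport (multiplicity s p0))).
  by exists p0.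
move=> /not_implyP[BK] /not_implyP[aut] /not_implyP[acyc] /existsNP[b].
move=> /existsNP[b'] /not_implyP[bB] /not_implyP[b'B] bb'.
pose p x := if p0 x \in B then b else p0 x.
have pB x : (p x \in B) = (p0 x \in B) by rewrite /p; case: ifP => // ->.
have ppE x : p0 x \notin B -> p x = p0 x by rewrite /p => /negbTE ->.
have ppB x : p0 x \in B -> p x = b by rewrite /p => ->.
have dsym x y z : x != y -> x != z -> d x y = d x z -> d y x = d z x.
  by move=> xy xz; rewrite (d_asym xy) (d_asym xz) => /negb_inj.
have [cross0 acyc0] := P0.
apply: (IH p).
  apply: leq_trans leN; apply: proper_card; apply/properP; split.
    apply/fintype.subsetP => _ /mem_msupport_multiplicity[x xs <-].
    rewrite /p; case: ifP => _; first by apply: (fintype.subsetP BK).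
    exact: msupport_multiplicity.
  exists b'; first exact: (fintype.subsetP BK).
  apply/mem_msupport_multiplicity => -[x xs]; rewrite /p.
  by case: ifP => [_ /bb'//|/negP xB e]; apply: xB; rewrite e.
split.
  move=> x y xs ys.
  have [xB|xB] := boolP (p0 x \in B); have [yB|yB] := boolP (p0 y \in B).
  - by rewrite !ppB // eqxx.
  - rewrite (ppB _ xB) (ppE _ yB) => by0.
    have ne : p0 x != p0 y by apply: contraNneq yB => <-.
    rewrite cross0 //; apply: dsym; rewrite 1?eq_sym //.
    by apply: aut => //; apply: msupport_multiplicity.
  - rewrite (ppB _ yB) (ppE _ xB) => bx0.
    have ne : p0 x != p0 y by apply: contraNneq xB => ->.
    by rewrite cross0 //; apply: aut => //; apply: msupport_multiplicity.
  - by rewrite !ppE //; apply: cross0.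
(* The only new fibre is the one over [b], the preimage of the acyclic set [B]. *)
move=> q; have [xB|qB] := boolP (b == q); last first.
  have qE x : p x = q -> p0 x = q.
    by move=> e; move: qB; rewrite -e /p; case: ifP => //; rewrite eqxx.
  by move=> x y z [xs /qE ex] [ys /qE ey] [zs /qE ez]; apply: (acyc0 q).
have qE x : p x = q -> p0 x \in B by rewrite -(eqP xB) -pB => ->.
apply: (@acyclic_on_preimage _ p0).
- by move=> x y [xs _] [ys _]; apply: cross0.
- by move=> r x y z [[xs _] ex] [[ys _] ey] [[zs _] ez]; apply: (acyc0 r).
- move=> _ _ _ [x [[_ /qE xq] <-]] [y [[_ /qE yq] <-]] [z [[_ /qE zq] <-]].
  exact: acyc.
Qed.

Lemma ltn_count (X : eqType) (P Q : pred X) (l : seq X) x : x \in l -> Q x -> ~~ P x ->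
  {in l, forall y, P y -> Q y} -> count P l < count Q l.
Proof.
move=> xl Qx Px PQ; rewrite -(size_filter Q) -(count_predC P) count_filter.
rewrite (_ : count (predI P Q) l = count P l).
  rewrite -addn1 leq_add2l -has_count; apply/hasP; exists x => //.
  by rewrite mem_filter Qx.
by apply: eq_in_count => y yl /=; case Py: (P y) => //=; apply: PQ.
Qed.

(** An acyclic tournament is a linear order; this is the position of [x] in its fibre. *)
Definition fibre_rank s p x := count (fun y => (p y == p x) && t y x) s.

Lemma fibre_rank_lt s p x y : presents s p -> x \in s -> y \in s ->
  p x = p y -> t x y -> fibre_rank s p x < fibre_rank s p y.
Proof.
move=> [_ acyc] xs ys e txy; apply: (ltn_count xs).
- by rewrite e eqxx.
- by rewrite t_irr andbF.
move=> z zs /andP[/eqP ez tzx]; rewrite ez e eqxx /=.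
have zy : z != y by apply: contraTneq tzx => ->; rewrite t_asymF.
by rewrite t_asym //; apply: (acyc (p x)) tzx txy.
Qed.

Lemma fibre_rank_lt_multiplicity s p x : x \in s ->
  fibre_rank s p x < multiplicity s p (p x).
Proof.
move=> xs; rewrite ffunE; apply: (ltn_count xs) => [||y ys /andP[]//].
  exact: eqxx.
by rewrite t_irr andbF.
Qed.

Lemma fibre_rank_inj s p x y : presents s p -> x \in s -> y \in s ->
  p x = p y -> fibre_rank s p x = fibre_rank s p y -> x = y.
Proof.
move=> P xs ys e er; apply/eqP/negPn/negP => xy.
have [txy|tyx] := boolP (t x y).
  by have := fibre_rank_lt P xs ys e txy; rewrite er ltnn.
have tyx' : t y x by rewrite t_asym 1?eq_sym.
by have := fibre_rank_lt P ys xs (esym e) tyx'; rewrite er ltnn.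
Qed.

Lemma fibre_rank_mono s p x y : presents s p -> x \in s -> y \in s ->
  p x = p y -> t x y = (fibre_rank s p x < fibre_rank s p y).
Proof.
move=> P xs ys e; have [->|xy] := eqVneq x y; first by rewrite t_irr ltnn.
apply/idP/idP; first exact: fibre_rank_lt.
by apply: contraTT; rewrite t_asym // negbK -leqNgt =>
  /(fibre_rank_lt P ys xs (esym e))/ltnW.
Qed.

(** The ranks are distinct and below the size of the fibre, so they exhaust the initial segment. *)
Lemma fibre_ranks s p q : uniq s -> presents s p ->
  perm_eq [seq fibre_rank s p x | x <- s & p x == q] (iota 0 (multiplicity s p q)).
Proof.
move=> us P; set l := map _ _.
have ul : uniq l.
  rewrite map_inj_in_uniq ?filter_uniq // => x y.
  rewrite !mem_filter => /andP[/eqP ex xs] /andP[/eqP ey ys].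
  by apply: fibre_rank_inj => //; rewrite ex ey.
have sz : size l = multiplicity s p q by rewrite size_map size_filter ffunE.
apply: uniq_perm; rewrite ?iota_uniq //.
have [] // := uniq_min_size ul (s2 := iota 0 (multiplicity s p q)).
  move=> _ /mapP[x + ->]; rewrite mem_filter mem_iota add0n => /andP[/eqP <- xs].
  exact: fibre_rank_lt_multiplicity.
by rewrite size_iota sz.
Qed.

Lemma fibre_rank_surj s p q i : uniq s -> presents s p -> i < multiplicity s p q ->
  exists x, [/\ x \in s, p x = q & fibre_rank s p x = i].
Proof.
move=> us P iq; have : i \in iota 0 (multiplicity s p q) by rewrite mem_iota.
rewrite -(perm_mem (fibre_ranks q us P)) => /mapP[x].
by rewrite mem_filter => /andP[/eqP ex xs] ->; exists x.
Qed.

Definition iso_on s s' (f g : V -> V) :=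
  [/\ {in s, forall x, f x \in s' /\ g (f x) = x},
      {in s', forall x, g x \in s /\ f (g x) = x} &
      {in s &, forall x y, t (f x) (f y) = t x y}].

(** Vertices with the same index and the same rank are matched: ranks decide the arcs inside fibres,
    [d] those between fibres. *)
Lemma iso_of_multiplicity s s' p p' : uniq s -> uniq s' ->
  presents s p -> presents s' p' -> multiplicity s p = multiplicity s' p' ->
  exists f g, iso_on s s' f g.
Proof.
have match_ranks l l' r r' : uniq l' -> presents l' r' ->
    multiplicity l r = multiplicity l' r' -> exists f : V -> V, forall x, x \in l ->
    [/\ f x \in l', r' (f x) = r x & fibre_rank l' r' (f x) = fibre_rank l r x].
  move=> ul P e; suff H x : exists y, x \in l ->
      [/\ y \in l', r' y = r x & fibre_rank l' r' y = fibre_rank l r x].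
    by have [f Hf] := choice H; exists f.
  have [xl|] := boolP (x \in l); last by exists x.
  have [|y Hy] := @fibre_rank_surj l' r' (r x) (fibre_rank l r x) ul P.
    by rewrite -e fibre_rank_lt_multiplicity.
  by exists y.
move=> us us' P P' e.
have [f Hf] := match_ranks s s' p p' us' P' e.
have [g Hg] := match_ranks s' s p' p us P (esym e).
exists f, g; split.
- move=> x xs; have [fs fp fr] := Hf _ xs; have [gs gp gr] := Hg _ fs.
  by split => //; apply: (fibre_rank_inj P) => //; rewrite ?gp ?gr.
- move=> x xs; have [gs gp gr] := Hg _ xs; have [fs fp fr] := Hf _ gs.
  by split => //; apply: (fibre_rank_inj P') => //; rewrite ?fp ?fr.
move=> x y xs ys; have [fx px rx] := Hf _ xs; have [fy py ry] := Hf _ ys.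
have [exy|ne] := eqVneq (p x) (p y).
  by rewrite (fibre_rank_mono P') ?px ?py // (fibre_rank_mono P) // rx ry.
by rewrite P'.1 ?px ?py // P.1.
Qed.

Lemma presents_iso s s' f g p : uniq s -> uniq s' -> iso_on s s' f g ->
  presents s p ->
  presents s' (p \o g) /\ multiplicity s' (p \o g) = multiplicity s p.
Proof.
move=> us us' [fK gK ft] [cross acyc].
have gt : {in s' &, forall x y, t (g x) (g y) = t x y}.
  move=> x y /gK[gx ex] /gK[gy ey]; by rewrite -{2}ex -{2}ey ft.
split; [split|].
- by move=> x y xs ys /= ne; rewrite -gt // cross //; [case: (gK _ xs)|case: (gK _ ys)].
- move=> q x y z [xs ex] [ys ey] [zs ez]; rewrite -(gt x y) // -(gt y z) // -(gt z x) //.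
  by apply: (acyc q); split => //; [case: (gK _ xs)|case: (gK _ ys)|case: (gK _ zs)].
- have ps : perm_eq s' (map f s).
    apply: uniq_perm => //; last first.
      move=> x; apply/idP/mapP => [/gK[gx <-]|[y /fK[fy _] ->]//].
      by exists (g x).
    by rewrite map_inj_in_uniq // => x y /fK[_ {2}<-] /fK[_ {2}<-] ->.
  apply/ffunP => q; rewrite !ffunE (seq.permP ps) count_map.
  by apply: eq_in_count => x /fK[_ /=] ->.
Qed.

Definition realizable w :=
  exists s p, [/\ uniq s, presents s p & multiplicity s p = w].

(** In each fibre the vertices of rank below the prescribed multiplicity are kept. *)
Lemma realizable_leq w w' : realizable w' -> (forall q, w q <= w' q) -> realizable w.
Proof.
move=> [s [p [us P <-]]] le; pose l := [seq x <- s | fibre_rank s p x < w (p x)].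
exists l, p; split; first exact: filter_uniq.
  split; first by move=> x y; rewrite !mem_filter => /andP[_ xs] /andP[_ ys]; apply: P.1.
  move=> q x y z; rewrite !mem_filter.
  move=> [/andP[_ xs] ex] [/andP[_ ys] ey] [/andP[_ zs] ez].
  exact: (P.2 q).
apply/ffunP => q; rewrite ffunE count_filter -[RHS](size_iota 0).
rewrite -size_filter -(size_map (fibre_rank s p)); apply/perm_size/uniq_perm.
- rewrite map_inj_in_uniq ?filter_uniq // => x y.
  rewrite !mem_filter => /andP[/andP[/eqP ex _] xs] /andP[/andP[/eqP ey _] ys].
  by apply: (fibre_rank_inj P) => //; rewrite ex ey.
- exact: iota_uniq.
move=> i; rewrite mem_iota add0n /=; apply/mapP/idP.
  by case=> x; rewrite mem_filter => /andP[/andP[/= /eqP <- ?] _] ->.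
move=> iw; have [|x [xs ex ei]] := @fibre_rank_surj s p q i us P.
  exact: leq_trans (le q).
by exists x => //; rewrite mem_filter /= xs ex ei eqxx iw.
Qed.

(** * Realizable multiplicities and infinite summands *)

Section Realizable.
Variable pi : V -> I.
Hypothesis pi_cross : forall x y, pi x != pi y -> t x y = d (pi x) (pi y).
Hypothesis pi_acyclic : forall q, acyclic_on t (fun x => pi x = q).

Definition infinite_fibre q := infinite_set [set x | pi x = q].

Lemma fresh_point s x : infinite_fibre (pi x) -> exists2 y, y \notin s & pi y = pi x.
Proof.
move=> inf; apply: contrapT => H; apply: inf; apply: (sub_finite_set _ (finite_seq s)).
move=> y /= e; apply/negPn/negP => ys; apply: H; by exists y.
Qed.

Lemma pi_fibre_constant s p : presents s p -> reduced (msupport (multiplicity s p)) ->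
  {in s &, forall x y, pi x = pi y -> p x = p y}.
Proof.
move=> P red x y xs ys e.
apply: (presents_constant P red (A := fun z => pi z = pi x)) => //.
  move=> v vs /eqP ne a a' sa sa' ea ea'.
  by rewrite !pi_cross ?ea ?ea'.
move=> a b c [_ ea] [_ eb] [_ ec]; exact: (pi_acyclic (q := pi x)).
Qed.

(** Outside their common summand [y] has the same arcs as [x], and by [pi_fibre_constant] the
    vertices of [s] in that summand all lie in the fibre of [x]; so [y] can join this fibre. *)
Lemma presents_add s p x y : presents s p -> reduced (msupport (multiplicity s p)) ->
  x \in s -> y \notin s -> pi y = pi x ->
  presents (y :: s) (fun z => if z == y then p x else p z).
Proof.
move=> P red xs ys e; set p' := fun z => _.
have p's z : z \in s -> p' z = p z.
  by rewrite /p'; case: eqP => // -> zs; rewrite zs in ys.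
have p'y : p' y = p x by rewrite /p' eqxx.
have far z : z \in s -> p x != p z -> pi x != pi z.
  by move=> zs; apply: contra_neq; apply: pi_fibre_constant P red _ _ xs zs.
have near z : pi x != pi z -> t y z = t x z /\ t z y = t z x.
  by move=> ne; rewrite !pi_cross ?e // eq_sym.
split.
  move=> a b; rewrite !inE => /predU1P[->|sa] /predU1P[->|sb];
    rewrite ?eqxx // ?p'y ?p's //.
  - by move=> ne; rewrite (near _ (far _ sb ne)).1 P.1.
  - by rewrite eq_sym => ne; rewrite (near _ (far _ sa ne)).2 P.1 1?eq_sym.
  - exact: P.1.
(* A 3-cycle through [y] has at most one further vertex in the fibre of [pi]
   through [y], and then replacing a vertex yields a 3-cycle in [s]. *)
have cyc a b : a \in s -> b \in s -> p a = p x -> p b = p x ->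
    t y a -> t a b -> ~~ t b y.
  move=> sa sb ea eb; have [ax|ax] := eqVneq (pi x) (pi a).
    have [bx|bx] := eqVneq (pi x) (pi b).
      by apply: (pi_acyclic (q := pi x)).
    move=> _; rewrite (near _ bx).2 pi_cross -?ax // => dxb.
    rewrite pi_cross 1?eq_sym // -pi_cross 1?eq_sym //.
    by rewrite t_asymF // pi_cross.
  have [bx|bx] := eqVneq (pi x) (pi b).
    rewrite (near _ ax).1 => txa; rewrite pi_cross -?bx 1?eq_sym //.
    by rewrite -pi_cross 1?eq_sym // (t_asymF txa).
  rewrite (near _ ax).1 (near _ bx).2; exact: (P.2 (p x)).
have mem_s z : z \in y :: s -> z != y -> z \in s.
  by rewrite inE => /predU1P[->|]; rewrite ?eqxx.
move=> q a b c [ma ea] [mb eb] [mc ec].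
have [ay|ay] := eqVneq a y; have [b_y|b_y] := eqVneq b y; have [cy|cy] := eqVneq c y;
  rewrite ?ay ?b_y ?cy ?t_irr // in ea eb ec *; rewrite ?p'y in ea eb ec;
  move: (mem_s _ ma) (mem_s _ mb) (mem_s _ mc); rewrite ?ay ?b_y ?cy.
- move=> _ /(_ isT) sb /(_ isT) sc; rewrite !p's // in eb ec.
  by apply: cyc => //; rewrite ?eb ?ec ea.
- move=> /(_ isT) sa _ /(_ isT) sc tay tyc; rewrite !p's // in ea ec.
  apply/negP => tca.
  by have /negP[] := cyc _ _ sc sa ltac:(congruence) ltac:(congruence) tyc tca.
- move=> /(_ isT) sa /(_ isT) sb _ tab tby; rewrite !p's // in ea eb.
  apply/negP => tya.
  by have /negP[] := cyc _ _ sa sb ltac:(congruence) ltac:(congruence) tya tab.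
- move=> /(_ isT) sa /(_ isT) sb /(_ isT) sc; rewrite !p's // in ea eb ec.
  exact: (P.2 q).
Qed.

Lemma enlarge s p x : uniq s -> presents s p -> reduced (msupport (multiplicity s p)) ->
  x \in s -> infinite_fibre (pi x) -> exists s' p', [/\ uniq s', presents s' p',
    {subset s <= s'}, {in s, p' =1 p} &
    multiplicity s' p' = [ffun q => (q == p x) + multiplicity s p q]].
Proof.
move=> us P red xs inf; have [y ys e] := fresh_point s inf.
have pE : {in s, (fun z => if z == y then p x else p z) =1 p}.
  by move=> z zs /=; case: eqP => // zy; rewrite -zy zs in ys.
exists (y :: s), (fun z => if z == y then p x else p z); split => //.
- by rewrite /= ys.
- exact: presents_add.
- by move=> z zs; rewrite inE zs orbT.
apply/ffunP => q; rewrite !ffunE /= eqxx eq_sym; congr (_ + _).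
by apply: eq_in_count => z /pE /= ->.
Qed.

(** Induction on the total deficit: [enlarge] adds one vertex and keeps the support, hence
    reducedness. *)
Lemma realizable_grow s p w : uniq s -> presents s p ->
  reduced (msupport (multiplicity s p)) ->
  (forall q, multiplicity s p q <= w q) ->
  (forall q, multiplicity s p q < w q ->
     exists x, [/\ x \in s, p x = q & infinite_fibre (pi x)]) ->
  realizable w.
Proof.
move: {2}_.+1 (ltnSn (\sum_q (w q - multiplicity s p q))) => N.
elim: N s p => // N IH s p; rewrite ltnS => leN us P red le_w inf.
have [eqw|/existsNP[q]] := pselect (forall q, multiplicity s p q = w q).
  by exists s, p; split => //; apply/ffunP.
move=> /eqP neq; have lt_w : multiplicity s p q < w q by rewrite ltn_neqAle neq le_w.
have [x [xs xq xinf]] := inf _ lt_w.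
have [s' [p' [us' P' ss' pp' mE]]] := enlarge us P red xs xinf.
have suppE : msupport (multiplicity s' p') = msupport (multiplicity s p).
  apply/setP => r; rewrite !inE mE ffunE; case: (r =P p x) => [->|//].
  by have := msupport_multiplicity p xs; rewrite inE => ->.
apply: (IH s' p') => //.
- apply: leq_trans leN; rewrite (bigD1 q) // [X in _ < X](bigD1 q) //= -addSn.
  rewrite mE ffunE xq eqxx leq_add //; first by lia.
  by apply: leq_sum => r /negbTE rq; rewrite ffunE rq.
- by rewrite suppE.
- by move=> r; rewrite mE ffunE xq; case: (r =P q) => [->|_]; [exact: lt_w|exact: le_w].
- move=> r; rewrite mE ffunE => lt; have [|z [zs zr zinf]] := inf r; first by lia.
  by exists z; rewrite ss' // pp'.
Qed.

Definition finite_part := [set x | ~ infinite_fibre (pi x)].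

Lemma finite_finite_part : finite_set finite_part.
Proof.
have -> : finite_part = \bigcup_(q in [set q | ~ infinite_fibre q]) [set x | pi x = q].
  apply/seteqP; split => x /=; first by move=> ?; exists (pi x).
  by case=> q /= nq e; rewrite /finite_part /= e.
by apply: bigcup_finite => [|q /contrapT//]; exact: finite_finset.
Qed.

(** One more than the number of vertices in finite summands: by pigeonhole, a fibre of this size
    contains a vertex of an infinite summand. *)
Definition threshold := (#|` fset_set finite_part|).+1.

Lemma large_multiplicity s p q : uniq s -> threshold <= multiplicity s p q ->
  exists x, [/\ x \in s, p x = q & infinite_fibre (pi x)].
Proof.
move=> us; rewrite ffunE -size_filter => le; apply: contrapT => H.
move: le; rewrite /threshold ltnNge => /negP; apply.
apply: uniq_leq_size; first exact: filter_uniq.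
move=> x; rewrite mem_filter in_fset_set; last exact: finite_finite_part.
by move=> /andP[/eqP xq xs]; rewrite inE /= => inf; apply: H; exists x.
Qed.

Definition truncate w : {ffun I -> nat} := [ffun q => minn (w q) threshold].

Lemma msupport_truncate w : msupport (truncate w) = msupport w.
Proof. by apply/setP => q; rewrite !inE ffunE /threshold; lia. Qed.

(** A coordinate lowered by truncation equals [threshold], so its fibre meets an infinite summand
    and can grow back. *)
Lemma realizable_truncate w : reduced (msupport w) ->
  realizable (truncate w) <-> realizable w.
Proof.
move=> red; split; last first.
  by move=> H; apply: realizable_leq H _ => q; rewrite ffunE geq_minl.
move=> [s [p [us P mE]]]; apply: (realizable_grow us P).
- by rewrite mE msupport_truncate.
- by move=> q; rewrite mE ffunE geq_minl.
- move=> q; rewrite mE ffunE => lt; apply: large_multiplicity => //.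
  by rewrite mE ffunE; lia.
Qed.

(** * Admissible multiplicities under partial automorphisms *)

Implicit Types (g h : {perm I}) (u v : {ffun I -> nat}).

Definition embeddings K : {set {perm I}} := [set g | embeds_on g K]%SET.

Lemma embeds_onP g K :
  reflect {in K &, forall a b, d (g a) (g b) = d a b} (embeds_on g K).
Proof.
apply: (iffP forall_inP) => [H a b aK bK|H a aK].
  by have /forall_inP/(_ b bK)/eqP := H a aK.
by apply/forall_inP => b bK; rewrite H.
Qed.

Lemma embeds_onM g h K : embeds_on g K ->
  embeds_on (g * h)%g K = embeds_on h [set g a | a in K]%SET.
Proof.
move=> /embeds_onP H; apply/embeds_onP/embeds_onP => H'.
  by move=> _ _ /imsetP[a aK ->] /imsetP[b bK ->]; rewrite -!permM H' // H.
by move=> a b aK bK; rewrite !permM H' ?H // imset_f.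
Qed.

Lemma embeds_onV g K : embeds_on g K -> embeds_on (g^-1)%g [set g a | a in K]%SET.
Proof.
move=> H; rewrite -embeds_onM // mulgV.
by apply/embeds_onP => a b _ _; rewrite !perm1.
Qed.

Lemma relabelM w g h : relabel (relabel w g) h = relabel w (g * h)%g.
Proof. by apply/ffunP => q; rewrite !ffunE invMg permM. Qed.

Lemma msupport_relabel w g : msupport (relabel w g) = [set g a | a in msupport w]%SET.
Proof.
apply/setP => q; rewrite inE ffunE; apply/idP/imsetP => [H|[a + ->]].
  by exists ((g^-1)%g q); rewrite ?inE // permKV.
by rewrite inE permK.
Qed.

Lemma weight_relabel w g : weight (relabel w g) = weight w.
Proof.
rewrite /weight (reindex_inj (@perm_inj _ g)) /=.
by apply: eq_bigr => q _; rewrite ffunE permK.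
Qed.

Lemma relabel_fixed w g : (relabel w g == w) = invariant_under g w.
Proof.
apply/eqP/forallP => [/ffunP H q|H]; last apply/ffunP => q.
  by have := H (g q); rewrite ffunE permK => ->.
by rewrite ffunE -(eqP (H _)) permKV.
Qed.

Lemma reduced_imset g K : reduced K -> embeds_on g K -> reduced [set g a | a in K]%SET.
Proof.
move=> red /embeds_onP H B BK aut acyc.
have memK a : g a \in [set g a | a in K]%SET = (a \in K).
  by rewrite mem_imset //; exact: perm_inj.
pose B' := [set a | g a \in B]%SET.
have B'K a : a \in B' -> a \in K by rewrite inE => /(fintype.subsetP BK); rewrite memK.
move=> b b' bB b'B; apply: (@perm_inj _ (g^-1)%g); apply: (red B').
- exact/fintype.subsetP.
- move=> v vK; rewrite inE => vB a a' aB aB'.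
  rewrite -(H v a vK (B'K _ aB)) -(H v a' vK (B'K _ aB')); apply: aut; rewrite ?memK //.
    by move: aB; rewrite inE.
  by move: aB'; rewrite inE.
- move=> x y z xB yB zB; rewrite -(H x y) ?B'K // -(H y z) ?B'K // -(H z x) ?B'K //.
  by apply: acyc; [move: xB|move: yB|move: zB]; rewrite inE.
- by rewrite inE permKV.
- by rewrite inE permKV.
Qed.

(** These functions are the invariants of finite subtournaments: they exist by [exists_reduced] and
    are unique up to [equivalent] by [presents_unique]. *)
Definition admissible w := `[< reduced (msupport w) /\ realizable w >].

Definition admissibles n := [fset w in compositions n | admissible w]%fset.

Lemma mem_admissibles n w : (w \in admissibles n) = (weight w == n) && admissible w.
Proof. by rewrite mem_fset_filter mem_compositions. Qed.

Definition equivalent u w :=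
  [exists g, embeds_on g (msupport u) && (w == relabel u g)].

Lemma admissible_relabel w g : admissible w -> embeds_on g (msupport w) ->
  admissible (relabel w g).
Proof.
move=> /asboolP[red [s [p [us P E]]]] emb; apply/asboolP; split.
  by rewrite msupport_relabel; apply: reduced_imset.
rewrite -E in emb; have [P' E'] := presents_relabel P emb.
by exists s, (g \o p); rewrite E' E.
Qed.

Definition stabilizer w : {set {perm I}} :=
  [set g in embeddings (msupport w) | relabel w g == w]%SET.

(** Orbit-stabilizer for partial automorphisms: those sending [w] to a given [u] form a translate of
    the stabilizer. *)
Lemma card_embeddings n w : w \in admissibles n ->
  #|embeddings (msupport w)| =
  (#|` [fset u in admissibles n | equivalent w u]%fset| * #|stabilizer w|)%N.
Proof.
rewrite mem_admissibles => /andP[wn adm].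
set C := [fset _ in _ | _]%fset.
have memC g : embeds_on g (msupport w) -> relabel w g \in C.
  move=> emb; rewrite mem_fset_filter mem_admissibles weight_relabel wn.
  rewrite admissible_relabel //=; apply/existsP; exists g; by rewrite emb /=.
have cardF u : u \in C ->
    #|[set g in embeddings (msupport w) | u == relabel w g]%SET| = #|stabilizer w|.
  rewrite mem_fset_filter => /andP[_ /existsP[g0 /andP[emb0 /eqP ->]]].
  rewrite -[RHS](card_imset _ (mulIg g0)); apply: eq_card => g.
  apply/idP/imsetP => [|[h + ->]].
    rewrite !inE => /andP[emb /eqP E]; exists (g * g0^-1)%g; rewrite ?mulgKV //.
    rewrite !inE -relabelM -E relabelM mulgV.
    rewrite embeds_onM // -msupport_relabel -E msupport_relabel embeds_onV //=.
    by apply/eqP/ffunP => q; rewrite ffunE invg1 perm1.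
  rewrite !inE => /andP[emb /eqP E]; rewrite -relabelM E eqxx andbT.
  by rewrite embeds_onM // -msupport_relabel E.
rewrite -sum1_card.
rewrite (eq_bigr (fun g => \sum_(u <- C) (u == relabel w g))) => [|g]; last first.
  rewrite inE => /memC H; rewrite -big_mkcond /= sum1_count.
  rewrite (eq_count (a2 := pred1 (relabel w g))) //.
  by rewrite count_uniq_mem ?fset_uniq // H.
rewrite exchange_big /= big_seq (eq_bigr (fun=> #|stabilizer w|)) => [|u uC]; last first.
  rewrite -(cardF u uC) -sum1_card -big_mkcondr /=.
  by apply: eq_bigl => g; rewrite [RHS]inE.
by rewrite -big_seq big_const_seq count_predT iter_addn_0 mulnC.
Qed.


(** * Burnside count and rationality *)

Section Counting.
Variables (F : numFieldType) (k : nat).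
Hypothesis k_large : forall v, reduced (msupport v) -> realizable v ->
  #|[set q | threshold <= v q]%SET| <= k.

(** By [card_embeddings], the inverse of the size of the class of [w] is the order of the stabilizer
    divided by the number of embeddings. *)
Lemma sum_stabilizers n (Y : choiceType) (f : {ffun I -> nat} -> Y) :
  {in admissibles n &, forall u w, (f u == f w) = equivalent w u} ->
  (#|` [fset f w | w in admissibles n]%fset|%:R =
   \sum_(w <- admissibles n)
     \sum_(g in stabilizer w) #|embeddings (msupport w)|%:R^-1 :> F)%R.
Proof.
move=> fE; rewrite card_imfset_inv big_seq [RHS]big_seq; apply: eq_bigr => w wn.
rewrite (_ : [fset y in admissibles n | f y == f w]%fset =
             [fset u in admissibles n | equivalent w u]%fset); last first.
  apply/fsetP => u; rewrite (mem_fset_filter (admissibles n)).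
  rewrite (mem_fset_filter (admissibles n) (equivalent w)).
  case: (boolP (u \in admissibles n)) => //= un.
  exact: fE.
rewrite big_const iter_addr addr0 -[RHS]mulr_natl (card_embeddings wn) natrM invfM.
rewrite mulrCA divff ?mulr1 // pnatr_eq0 -lt0n; apply/card_gt0P.
exists 1%g; rewrite !inE; apply/andP; split; last first.
  by apply/eqP/ffunP => q; rewrite ffunE invg1 perm1.
by apply/embeds_onP => a b _ _; rewrite !perm1.
Qed.

Definition untruncated v : {set I} := [set q | threshold <= v q]%SET.

Lemma grows_on_truncate v w : (forall q, v q <= threshold) ->
  grows_on (untruncated v) v w = (truncate w == v).
Proof.
move=> le; apply/forallP/eqP => [H|<- q].
  apply/ffunP => q; have := H q; have := le q; rewrite ffunE inE => vq.
  case: ifP => [h wq|_ /eqP ->]; last exact/minn_idPl.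
  have e : v q = threshold by apply/eqP; rewrite eqn_leq vq h.
  by rewrite -e; apply/minn_idPr.
rewrite inE !ffunE; case: ifP => [_|/negbT]; first exact: geq_minl.
by rewrite leq_min leqnn andbT -ltnNge => /ltnW/minn_idPl ->.
Qed.

Lemma truncate_leq w q : truncate w q <= threshold.
Proof. by rewrite ffunE geq_minr. Qed.

Lemma admissible_truncate w : admissible (truncate w) = admissible w.
Proof.
apply/asboolP/asboolP; rewrite msupport_truncate => -[red H];
by split => //; apply/(realizable_truncate red).
Qed.

Lemma invariant_under_truncate g w :
  invariant_under g w -> invariant_under g (truncate w).
Proof. by move=> /forallP H; apply/forallP => q; rewrite !ffunE (eqP (H q)). Qed.

(* Each truncation class of admissible multiplicities is a product of points
   and rays, so its [g]-invariant members are counted by [growths]. *)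
Lemma ratl_stabilizers :
  ratl k (fun n => \sum_(w <- admissibles n)
     \sum_(g in stabilizer w) #|embeddings (msupport w)|%:R^-1 : F)%R.
Proof.
(* Truncations have values at most [threshold], so they range over a finite type and the outer sums
   do not depend on [n]. *)
pose VT := {ffun I -> 'I_threshold.+1}.
pose val_of (x : VT) : {ffun I -> nat} := [ffun q => val (x q)].
pose ok (g : {perm I}) v :=
  [&& admissible v, embeds_on g (msupport v) & invariant_under g v].
pose c v : F := (#|embeddings (msupport v)|%:R^-1)%R.
pose term g v n : F :=
  (if ok g v then c v * #|` growths g (untruncated v) v n|%:R else 0)%R.
apply: (@ratl_ext _ _ (fun n => \sum_g \sum_(x : VT) term g (val_of x) n)%R).
  move=> n; apply/esym.
  rewrite (eq_bigr (fun w => \sum_g if g \in stabilizer w then c w else 0)%R); last first.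
    by move=> w _; rewrite -big_mkcond.
  rewrite exchange_big /=; apply: eq_bigr => g _.
  rewrite -big_mkcond (_ : (\sum_(w <- _ | _) _ =
      \sum_(w <- compositions n | ok g w) c w)%R); last first.
    rewrite -big_filter -[RHS]big_filter; apply/perm_big/uniq_perm.
    - by rewrite filter_uniq ?fset_uniq.
    - by rewrite filter_uniq ?fset_uniq.
    move=> w; rewrite !mem_filter mem_admissibles mem_compositions !inE.
    by rewrite relabel_fixed /ok; case: (weight w == n); rewrite ?andbF ?andbT //= andbC.
  pose h w : VT := [ffun q => inord (truncate w q)].
  have hE w (x : VT) : (h w == x) = (truncate w == val_of x).
    apply/eqP/eqP => [<-|/ffunP E].
      apply/ffunP => q; have e : val (h w q) = truncate w q.
        by rewrite [h w q]ffunE /= inordK // ltnS truncate_leq.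
      by rewrite [RHS]ffunE e.
    by apply/ffunP => q; rewrite [LHS]ffunE E ffunE inord_val.
  rewrite (partition_big h predT) //=; apply: eq_bigr => x _; rewrite /term.
  set v := val_of x.
  have vle q : v q <= threshold by rewrite ffunE -ltnS ltn_ord.
  have E w : ok g w && (h w == x) =
      ok g v && (invariant_under g w && grows_on (untruncated v) v w).
    rewrite hE grows_on_truncate // -/v; case: eqP => [<-|]; rewrite ?andbF // !andbT.
    rewrite /ok admissible_truncate msupport_truncate.
    by case: (boolP (invariant_under g w)) => [/invariant_under_truncate ->|];
      rewrite ?andbF ?andbT.
  rewrite (eq_bigl _ _ E) (eq_bigr (fun=> c v)) => [|w]; last first.
    move=> /andP[_ /andP[_]]; rewrite grows_on_truncate // => /eqP <-.
    by rewrite /c msupport_truncate.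
  rewrite big_const_seq iter_addr addr0.
  case: (ok g v) => /=; last by rewrite count_pred0.
  rewrite -[LHS]mulr_natr; congr (_ * _%:R)%R.
  rewrite -size_filter; apply/perm_size/uniq_perm; rewrite ?filter_uniq ?fset_uniq //.
  by move=> w; rewrite mem_filter mem_growths mem_compositions andbC.
(* A nonzero term has at most [k] rays by [k_large]. *)
apply: ratl_sum => g; apply: ratl_sum => x; rewrite /term.
case: (boolP (ok g (val_of x))) => [/and3P[/asboolP[red re] _ inv]|_]; last exact: ratl0.
apply: ratlZ; apply: (ratl_leq (k_large red re)); apply: ratl_growths => // q.
by rewrite !inE (eqP (forallP inv q)).
Qed.

End Counting.

(** Each admissible function has weight at least the inverse of the number of permutations in the
    Burnside sum. *)
Lemma card_admissibles_leq n (Y : choiceType) (f : {ffun I -> nat} -> Y) :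
  {in admissibles n &, forall u w, (f u == f w) = equivalent w u} ->
  #|` admissibles n| <= #|{perm I}| * #|` [fset f w | w in admissibles n]%fset|.
Proof.
move=> fE; rewrite -(ler_nat rat) natrM (sum_stabilizers rat fE) mulr_sumr.
rewrite card_fset_sum1 natr_sum big_seq [X in (_ <= X)%R]big_seq.
apply: ler_sum => w wn; rewrite big_const iter_addr addr0 -[X in (_ * X)%R]mulr_natl.
have P0 : 0 < #|embeddings (msupport w)|.
  apply/card_gt0P; exists 1%g; rewrite inE; apply/embeds_onP => a b _ _.
  by rewrite !perm1.
have S0 : 0 < #|stabilizer w|.
  move: P0; rewrite (card_embeddings wn) muln_gt0 => /andP[_ //].
rewrite mulrCA mulr_ege1 ?ler1n //.
by rewrite ler_pdivlMr ?ltr0n // mul1r ler_nat max_card.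
Qed.


(** * A lower bound from freely growing coordinates *)

Section LowerBound.
Variables (s : seq V) (p : V -> I) (L : {set I}) (z : I).
Hypotheses (us : uniq s) (P : presents s p).
Hypothesis red : reduced (msupport (multiplicity s p)).
Hypothesis L_inf : forall q, q \in L ->
  exists x, [/\ x \in s, p x = q & infinite_fibre (pi x)].
Hypothesis zL : z \in L.

Let w0 := multiplicity s p.

Lemma admissible_grow w : (forall q, w0 q <= w q) ->
  (forall q, q \notin L -> w q = w0 q) -> admissible w.
Proof.
move=> le out; apply/asboolP; split; last first.
  apply: (realizable_grow us P red le) => q lt; apply: L_inf.
  by apply/negPn/negP => /out e; move: lt; rewrite e ltnn.
suff -> : msupport w = msupport w0 by [].
apply/setP => q; have [/L_inf[x [xs <- _]]|/out e] := boolP (q \in L); last first.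
  by rewrite !inE e.
have := msupport_multiplicity p xs; rewrite -/w0 => h; rewrite h.
by move: h; rewrite !inE -!lt0n => h; apply: leq_trans (le _).
Qed.

(** On [L] without [z] any excess up to [m] is allowed, and [z] absorbs the remaining weight, which
    is nonnegative by the bound on [n]. *)
Lemma card_admissibles_geq m n : weight w0 + #|I| * m <= n ->
  m.+1 ^ #|L|.-1 <= #|` admissibles n|.
Proof.
move=> le_n.
pose Y := {ffun I -> 'I_m.+1}.
pose dom : pred Y := [in pffun_on ord0 [in L :\ z] predT].
pose sumY (y : Y) := \sum_q val (y q).
have sumYle y : sumY y <= #|I| * m.
  have -> : #|I| * m = \sum_(q : I) m by rewrite sum_nat_const.
  by apply: leq_sum => q _; rewrite -ltnS ltn_ord.
pose grow (y : Y) : {ffun I -> nat} :=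
  [ffun q => w0 q + (if q == z then n - (weight w0 + sumY y) else y q)].
have domP y : dom y -> forall q, q \notin L :\ z -> y q = ord0.
  move=> /pffun_onP[/supportP supp _] q qL; exact: supp.
have grow_inj : {in dom &, injective grow}.
  move=> y y' /domP dy /domP dy' /ffunP E; apply/ffunP => q.
  have [qz|qz] := eqVneq q z.
    by rewrite dy ?dy' // !inE qz eqxx.
  by apply: val_inj; have := E q; rewrite !ffunE (negbTE qz) => /addnI.
have sz : #|dom| = m.+1 ^ #|L|.-1.
  by rewrite card_pffun_on card_ord [#|[in L]|](cardsD1 z) zL.
rewrite -sz cardE -(size_map grow); apply: uniq_leq_size.
  rewrite map_inj_in_uniq ?enum_uniq // => y y'; rewrite !mem_enum.
  exact: grow_inj.
move=> _ /mapP[y + ->]; rewrite mem_enum => dy.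
rewrite mem_admissibles; apply/andP; split.
  rewrite /weight (eq_bigr (fun q =>
    w0 q + (if q == z then n - (weight w0 + sumY y) else y q))); last first.
    by move=> q _; rewrite ffunE.
  rewrite big_split /= -/(weight w0) (bigD1 z) //= eqxx.
  rewrite (eq_bigr (fun q => val (y q))) => [|q /negbTE -> //].
  have -> : \sum_(q | q != z) val (y q) = sumY y.
    by rewrite /sumY [RHS](bigD1 z) //= (domP _ dy) // !inE eqxx.
  have := sumYle y; move: le_n; move: (weight w0) (sumY y) (#|I| * m)%N => a b c; lia.
apply: admissible_grow => q; first by rewrite [grow y q]ffunE leq_addr.
move=> qL; rewrite [grow y q]ffunE.
have /negbTE -> : q != z by apply: contraNneq qL => ->.
by rewrite (domP _ dy) ?addn0 // !inE (negbTE qL) andbF.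
Qed.

End LowerBound.

End Realizable.
End Types.
(** * Acyclic components and the profile *)

Section TournamentRelation.
Variables (V : choiceType) (T : tournament V).

Definition tournament_rel : rel V := fun x y => `[< T x y >].
Local Notation t := tournament_rel.

Lemma tournament_rel_irr : irreflexive t.
Proof. by move=> x; apply/asboolP; exact: tournament_irreflexive. Qed.

Lemma tournament_rel_asym x y : x != y -> t x y = ~~ t y x.
Proof.
move=> /eqP xy; apply/asboolP/idP => [Txy|].
  by apply/asboolP => Tyx; apply: xy; apply: tournament_antisymmetric Tyx.
by move=> /asboolP nyx; have [] := tournament_complete T xy.
Qed.

End TournamentRelation.

Section AcyclicComponents.
Variables (V : choiceType) (T : tournament V).
Local Notation t := (tournament_rel T).

Lemma autonomousP (A : set V) :
  autonomous T A <-> forall v, ~ A v -> forall a a', A a -> A a' -> t v a = t v a'.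
Proof.
have ne v a : ~ A v -> A a -> a != v.
  by move=> Av Aa; apply/eqP => e; apply: Av; rewrite -e.
split=> [H v Av a a' Aa Aa'|H v Av].
  have [dom|dom] := H v Av; first by apply/asboolP/asboolP => _; apply: dom.
  have F b : A b -> t v b = false.
    move=> Ab.
    by apply: (t_asymF (tournament_rel_irr T) (tournament_rel_asym T)); apply/asboolP/dom.
  by rewrite !F.
have [[a Aa]|A0] := pselect (exists a, A a); last by left => a Aa; case: A0; exists a.
case: (boolP (t v a)) => va; [left|right] => b Ab.
  by apply/asboolP; rewrite -/(t v b) (H v Av b a).
by apply/asboolP; rewrite -/(t b v) tournament_rel_asym ?ne // (H v Av b a).
Qed.

Lemma acyclic_inducedP (A : set V) : acyclic (Defs.induced T A) <-> acyclic_on t A.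
Proof.
split=> [H x y z Ax Ay Az /asboolP xy /asboolP yz|H [x [y [z [xy yz zx]]]]].
  apply/asboolP => zx; apply: H.
  by exists (exist _ x (mem_set Ax)), (exist _ y (mem_set Ay)), (exist _ z (mem_set Az)).
have := H (val x) (val y) (val z) (set_valP x) (set_valP y) (set_valP z).
by move=> /(_ (asboolT xy) (asboolT yz)) /asboolP; apply.
Qed.

Lemma autonomous_setU (A B : set V) x : A x -> B x ->
  autonomous T A -> autonomous T B -> autonomous T (A `|` B).
Proof.
move=> Ax Bx /autonomousP aA /autonomousP aB; apply/autonomousP => v nAB.
have nA : ~ A v by move=> ?; apply: nAB; left.
have nB : ~ B v by move=> ?; apply: nAB; right.
have E a : (A `|` B) a -> t v a = t v x.
  by case=> ?; [exact: aA|exact: aB].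
by move=> a a' /E -> /E ->.
Qed.

(* Two of the three vertices of a 3-cycle in [A `|` B] lie in the same one of
   these two autonomous sets, which therefore contains the third. *)
Lemma acyclic_setU (A B : set V) :
  autonomous T A -> autonomous T B ->
  acyclic_on t A -> acyclic_on t B -> acyclic_on t (A `|` B).
Proof.
have two (C : set V) : autonomous T C -> acyclic_on t C ->
    forall x y z, C x -> C y -> t x y -> t y z -> ~~ t z x.
  move=> /autonomousP aut acyc x y z Cx Cy xy yz.
  have [Cz|nCz] := pselect (C z); first exact: acyc xy yz.
  have F := t_asymF (tournament_rel_irr T) (tournament_rel_asym T).
  by rewrite (aut z nCz x y Cx Cy) (F _ _ yz).
have rot x y z : (t y z -> t z x -> ~~ t x y) -> t x y -> t y z -> ~~ t z x.
  by move=> H xy yz; apply/negP => zx; have := H yz zx; rewrite xy.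
have rot' x y z : (t z x -> t x y -> ~~ t y z) -> t x y -> t y z -> ~~ t z x.
  by move=> H xy yz; apply/negP => zx; have := H zx xy; rewrite yz.
move=> aA aB cA cB x y z [Ax|Bx] [Ay|By] [Az|Bz].
- exact: two aA cA _ _ _ Ax Ay.
- exact: two aA cA _ _ _ Ax Ay.
- by apply: rot'; apply: two aA cA _ _ _ Az Ax.
- by apply: rot; apply: two aB cB _ _ _ By Bz.
- by apply: rot; apply: two aA cA _ _ _ Ay Az.
- by apply: rot'; apply: two aB cB _ _ _ Bz Bx.
- exact: two aB cB _ _ _ Bx By.
- exact: two aB cB _ _ _ Bx By.
Qed.

(** Acyclic autonomous sets sharing a vertex can be merged, so lying in a common one is an
    equivalence relation. *)
Lemma acyclic_component_eq x y :
  acyclic_component T x y -> acyclic_component T x = acyclic_component T y.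
Proof.
have sub a b z : acyclic_component T a b ->
    acyclic_component T b z -> acyclic_component T a z.
  move=> [A [aA /acyclic_inducedP cA Aa] Ab] [B [aB /acyclic_inducedP cB Bb] Bz].
  exists (A `|` B); last by right.
  split; [exact: (autonomous_setU Ab Bb aA aB)|apply/acyclic_inducedP|by left].
  exact: acyclic_setU.
move=> xy; have yx : acyclic_component T y x.
  by case: xy => A [aA cA Ax] Ay; exists A.
by apply/seteqP; split => z; apply: sub.
Qed.

Lemma acyclic_component_refl x : acyclic_component T x x.
Proof.
exists [set x] => //; split => //.
- by apply/autonomousP => v _ a a' -> ->.
- apply/acyclic_inducedP => _ _ _ -> -> ->; by rewrite tournament_rel_irr.
Qed.

(** Total maps on [V] replace bijections of subtypes, so that they can be mapped over lists of
    vertices. *)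
Lemma isomorphic_inducedP (A B : set V) :
  isomorphic (Defs.induced T A) (Defs.induced T B) <->
  exists f g : V -> V, [/\ forall x, A x -> B (f x) /\ g (f x) = x,
    forall x, B x -> A (g x) /\ f (g x) = x &
    forall x y, A x -> A y -> t (f x) (f y) = t x y].
Proof.
have lift (C D : set V) (f : C -> D) : exists f' : V -> V,
    forall x (Cx : C x), f' x = val (f (exist _ x (mem_set Cx))).
  have [|f' Hf'] := @choice _ _ (fun x y =>
      forall Cx : C x, y = val (f (exist _ x (mem_set Cx)))).
    move=> x.
    have [Cx|nCx] := pselect (C x); last by exists x.
    exists (val (f (exist _ x (mem_set Cx)))) => Cx'.
    by rewrite (Prop_irrelevance Cx Cx').
  by exists f'.
split=> [[f [[g fK gK] fT]]|[f [g [fK gK ft]]]].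
  have [[f' Hf] [g' Hg]] := (lift _ _ f, lift _ _ g).
  exists f', g'; split.
  - move=> x Ax; rewrite (Hf x Ax); have Bfx := set_valP (f (exist _ x (mem_set Ax))).
    split => //; rewrite (Hg _ Bfx).
    rewrite (_ : exist _ _ _ = f (exist _ x (mem_set Ax))) ?fK //; exact: val_inj.
  - move=> x Bx; rewrite (Hg x Bx); have Agx := set_valP (g (exist _ x (mem_set Bx))).
    split => //; rewrite (Hf _ Agx).
    rewrite (_ : exist _ _ _ = g (exist _ x (mem_set Bx))) ?gK //; exact: val_inj.
  - move=> x y Ax Ay; rewrite (Hf x Ax) (Hf y Ay).
    have := fT (exist _ x (mem_set Ax)) (exist _ y (mem_set Ay)).
    by rewrite /= /t => H; apply/asboolP/asboolP => /H.
pose F (x : A) : B := exist _ (f (val x)) (mem_set (fK _ (set_valP x)).1).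
pose G (x : B) : A := exist _ (g (val x)) (mem_set (gK _ (set_valP x)).1).
exists F; split.
  by exists G => x; apply: val_inj => /=;
    [case: (fK _ (set_valP x))|case: (gK _ (set_valP x))].
move=> x y /=; have E := ft _ _ (set_valP x) (set_valP y).
rewrite /tournament_rel in E.
by split=> H; apply/asboolP; [rewrite E|rewrite -E]; apply/asboolP.
Qed.

(** * The profile and the components of a lexicographic sum *)

Section Presented.
Variables (I : finType) (D : tournament I) (pi : V -> I).
Let d := tournament_rel D.
Hypothesis pi_cross : forall x y, pi x != pi y -> t x y = d (pi x) (pi y).
Hypothesis pi_acyclic : forall q, acyclic_on t (fun x => pi x = q).

Let d_irr : irreflexive d := tournament_rel_irr D.
Let d_asym x y : x != y -> d x y = ~~ d y x := @tournament_rel_asym _ D x y.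

Definition copies (w : {ffun I -> nat}) : set (set V) :=
  [set B | exists s p, [/\ uniq s, B = [set` s],
     presents t d s p & multiplicity s p = w]].

(** Isomorphisms transport presentations, and conversely equal multiplicities give an
    isomorphism. *)
Lemma iso_class_copies s p : uniq s -> presents t d s p ->
  iso_class T [set` s] = copies (multiplicity s p).
Proof.
move=> us P; apply/seteqP; split => B /=.
  move=> /isomorphic_inducedP[f [g [fK gK ft]]].
  pose s' := map f s.
  have us' : uniq s'.
    rewrite map_inj_in_uniq // => x y xs ys e.
    by rewrite -(fK x xs).2 -(fK y ys).2 e.
  have BE : B = [set` s'].
    apply/seteqP; split => x /=.
      by move=> /gK[gx <-]; apply: map_f.
    by move=> /mapP[y ys ->]; case: (fK y ys).
  have iso : iso_on t s s' f g.
    split.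
    - by move=> x xs; split; [exact: map_f|case: (fK x xs)].
    - by move=> _ /mapP[x xs ->]; have [Bfx ->] := fK x xs.
    - by move=> x y xs ys; apply: ft.
  have [P' E] := presents_iso us us' iso P.
  by exists s', (p \o g).
move=> [s' [p' [us' -> P' E]]]; apply/isomorphic_inducedP.
have [f [g [fK gK ft]]] :=
  iso_of_multiplicity (tournament_rel_irr T) (tournament_rel_asym T) us us' P P' (esym E).
by exists f, g.
Qed.

Lemma copies_eq n : {in admissibles t d n &, forall u w,
  (copies u == copies w) = equivalent d w u}.
Proof.
move=> u w; rewrite !mem_admissibles.
move=> /andP[_ /asboolP[redu [s [p [us P E]]]]].
move=> /andP[_ /asboolP[redw [s' [p' [us' P' E']]]]].
apply/eqP/existsP => [e|[g /andP[emb /eqP eu]]].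
  have : copies w [set` s] by rewrite -e; exists s, p.
  move=> [l [r [ul sl R F]]].
  have sE : s =i l.
    by move=> x; have /seteqP[A B] := sl; apply/idP/idP; [exact: A|exact: B].
  have ps : perm_eq s l by apply: uniq_perm.
  have Ml : multiplicity s r = w.
    by rewrite -F; apply/ffunP => q; rewrite !ffunE (seq.permP ps).
  have Pl : presents t d s r.
    by split=> [x y|q x y z]; rewrite !sE; [exact: R.1|exact: R.2].
  rewrite -Ml in redw *; rewrite -E in redu.
  have [g emb gE] := presents_unique d_irr Pl P redw redu.
  exists g; rewrite emb /= -(presents_relabel Pl emb).2 -E.
  apply/eqP/ffunP => q; rewrite !ffunE; apply: eq_in_count => x xs /=.
  by rewrite gE.
rewrite eu -E'; rewrite -E' in emb; have [Pg Eg] := presents_relabel P' emb.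
by rewrite -Eg -!iso_class_copies.
Qed.

Lemma presents_pi s : presents t d s pi.
Proof.
split=> [x y _ _|q x y z [_ ex] [_ ey] [_ ez]]; first exact: pi_cross.
exact: (@pi_acyclic q).
Qed.

Lemma profile_copies n :
  profile T n = #|` [fset copies w | w in admissibles t d n]%fset|.
Proof.
rewrite /profile (_ : iso_classes T n = copies @` [set` admissibles t d n]).
  rewrite fset_set_image; last exact: finite_fset.
  by rewrite set_fsetK.
apply/seteqP; split => C /=.
  move=> [A An <-].
  have finA : finite_set A by apply/finite_setP; exists n.
  pose s : seq V := fset_set A.
  have AE : A = [set` s] by rewrite -[LHS](fset_setK finA).
  have us : uniq s by exact: fset_uniq.
  have [p P red] := exists_reduced d_asym (presents_pi s).
  exists (multiplicity s p); last by rewrite AE (iso_class_copies us P).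
  rewrite mem_admissibles; apply/andP; split; last first.
    by apply/asboolP; split => //; exists s, p.
  by rewrite weight_multiplicity -(card_fset_set An).
move=> [w]; rewrite mem_admissibles => /andP[/eqP wn /asboolP[red [s [p [us P E]]]]] <-.
exists [set` s]; last by rewrite (iso_class_copies us P) E.
have -> : [set` s] = [set` [fset x in s]%fset].
  by apply/seteqP; split => x /=; rewrite inE.
apply/card_eq_fsetP; by rewrite card_fseq undup_id // -wn -E weight_multiplicity.
Qed.

Lemma pi_fibre_component x y : pi x = pi y ->
  acyclic_component T x = acyclic_component T y.
Proof.
move=> e; apply: acyclic_component_eq; exists [set z | pi z = pi y] => //; split => //.
- apply/autonomousP => v /= /eqP ne a a' ea ea'.
  by rewrite !pi_cross ?ea ?ea'.
- by apply/acyclic_inducedP; exact: pi_acyclic.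
Qed.

(** Each summand lies in one component, and a component without vertices of infinite summands is
    contained in the finite part. *)
Lemma infinite_acyclic_componentsE : infinite_acyclic_components T =
  [set acyclic_component T x | x in [set x | infinite_fibre pi (pi x)]].
Proof.
apply/seteqP; split => C /=.
  move=> [Cinf [x Cx]].
  have [y Cy yinf] : exists2 y, C y & infinite_fibre pi (pi y).
    apply: contrapT => H; apply: Cinf; apply: sub_finite_set (finite_finite_part pi).
    by move=> y Cy inf; apply: H; exists y.
  by exists y => //; rewrite Cx in Cy *; rewrite -(acyclic_component_eq Cy).
move=> [x xinf <-]; split; last by exists x.
move=> fin; apply: xinf; apply: sub_finite_set fin => y /= e.
by rewrite -(pi_fibre_component e); apply: acyclic_component_refl.
Qed.

Lemma finite_infinite_acyclic_components : finite_set (infinite_acyclic_components T).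
Proof.
rewrite infinite_acyclic_componentsE.
pose G q := [set y | exists x, pi x = q /\ acyclic_component T x y].
apply: (@sub_finite_set _ _ (range G)); last exact: finite_image finite_finset.
move=> _ [x _ <-]; exists (pi x) => //; apply/seteqP; split => y /=.
  by move=> [z [/pi_fibre_component <-]].
by move=> xy; exists x.
Qed.

Local Notation k := #|` fset_set (infinite_acyclic_components T)|.

Lemma mem_infinite_components x : infinite_fibre pi (pi x) ->
  acyclic_component T x \in fset_set (infinite_acyclic_components T).
Proof.
move=> inf; rewrite in_fset_set; last exact: finite_infinite_acyclic_components.
by rewrite infinite_acyclic_componentsE; apply/mem_set; exists x.
Qed.

Lemma presents_component s p x y : presents t d s p ->
  reduced d (msupport (multiplicity s p)) -> x \in s -> y \in s ->
  acyclic_component T x = acyclic_component T y -> p x = p y.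
Proof.
move=> P red xs ys e; have := acyclic_component_refl y.
rewrite -e => -[A [/autonomousP aA /acyclic_inducedP cA Ax] Ay].
apply: (presents_constant d_irr P red (A := A)) => //.
  by move=> v _ nAv a a' _ _; apply: aA.
by move=> a b c [_ Aa] [_ Ab] [_ Ac]; apply: cA.
Qed.

(** Each large coordinate has a vertex in an infinite component; by [presents_component] different
    coordinates give different components. *)
Lemma card_untruncated (v : {ffun I -> nat}) : reduced d (msupport v) ->
  realizable t d v -> (#|[set q | threshold pi <= v q]%SET| <= k)%N.
Proof.
move=> red [s [p [us P E]]]; rewrite -E in red *.
set U := [set q | _]%SET.
have /(@choice _ _ _)[X HX] : forall q, exists C : set V, q \in U -> exists x,
    [/\ x \in s, p x = q, infinite_fibre pi (pi x) & C = acyclic_component T x].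
  move=> q; have [|_] := boolP (q \in U); last by exists set0.
  rewrite inE => /(large_multiplicity us)[x [xs xq inf]].
  by exists (acyclic_component T x) => _; exists x.
rewrite cardE -(size_map X); apply: uniq_leq_size.
  rewrite map_inj_in_uniq ?enum_uniq // => q q'; rewrite !mem_enum.
  move=> /HX[x [xs <- _ ->]] /HX[y [ys <- _ ->]].
  exact: (presents_component P red).
move=> _ /mapP[q + ->]; rewrite mem_enum => /HX[x [_ _ inf ->]].
exact: mem_infinite_components.
Qed.

(* One point in each nonempty fibre of [pi]: distinct infinite acyclic
   components then meet distinct fibres of a reduced presentation. *)
Lemma growable_presentation : exists s p (L : {set I}),
  [/\ uniq s, presents t d s p, reduced d (msupport (multiplicity s p)),
   (forall q, q \in L -> exists x, [/\ x \in s, p x = q & infinite_fibre pi (pi x)]) &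
   (k <= #|L|)%N].
Proof.
(* [r] picks one representative in each nonempty summand. *)
have [r rP] : exists r : V -> V, (forall x, pi (r x) = pi x) /\
    (forall x y, pi x = pi y -> r x = r y).
  have /(@choice _ _ _)[c Hc] : forall i, exists o : option V,
      forall x, pi x = i -> exists2 y, o = Some y & pi y = i.
    move=> i; have [[x xi]|H] := pselect (exists x, pi x = i).
      by exists (Some x) => _ _; exists x.
    by exists None => x xi; case: H; exists x.
  exists (fun x => odflt x (c (pi x))); split=> [x|x y e].
    by have [y -> /=] := Hc _ x erefl.
  by rewrite e; have [z -> _] := Hc _ y erefl.
have [rpi rE] := rP.
have fin_r : finite_set (range r).
  pose G i : set V := [set r x | x in [set x | pi x = i]].
  have -> : range r = \bigcup_(i in [set: I]) G i.
    apply/seteqP; split => [_ [x _ <-]|_ [i _ [x _ <-]]]; last by exists x.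
    by exists (pi x) => //; exists x.
  apply: bigcup_finite => [|i _]; first exact: finite_finset.
  have [[x xi]|H] := pselect (exists x, pi x = i).
    apply: (@sub_finite_set _ _ [set r x]); last exact: finite_set1.
    by move=> _ [y /= yi <-]; apply: rE; rewrite yi.
  by apply: (@sub_finite_set _ _ set0) => // _ [y /= yi _]; case: H; exists y.
pose s : seq V := fset_set (range r).
have us : uniq s by exact: fset_uniq.
have rs x : r x \in s by rewrite in_fset_set //; apply/mem_set; exists x.
have [p P red] := exists_reduced d_asym (presents_pi s).
pose L := [set q | `[< exists x, [/\ x \in s, p x = q & infinite_fibre pi (pi x)] >]]%SET.
exists s, p, L; split => // [q|]; first by rewrite inE => /asboolP.
(* The vertices whose representatives share a fibre of [p] form an acyclic autonomous set of [T]. *)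
have fibre_component x y : p (r x) = p (r y) ->
      acyclic_component T x = acyclic_component T y.
  move=> e; apply: acyclic_component_eq.
  exists [set z | p (r z) = p (r y)] => //; split => //.
    apply/autonomousP => v /= /eqP ne a a' ea ea'.
    have E b : p (r b) = p (r y) -> t v b = d (p (r v)) (p (r y)).
      move=> eb; have nb : pi v != pi b.
        by apply: contra_neq ne => /rE ->.
      by rewrite pi_cross // -(rpi v) -(rpi b) -pi_cross ?rpi // P.1 ?eb.
    by rewrite !E.
  apply/acyclic_inducedP; apply: (acyclic_on_preimage d_asym (p := pi)).
  - by move=> a b _ _; apply: pi_cross.
  - by move=> q a b c [_ ea] [_ eb] [_ ec]; apply: (@pi_acyclic q).
  - move=> _ _ _ [a [/= ea <-]] [b [/= eb <-]] [c [/= ec <-]].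
    have [->|ab] := eqVneq (pi a) (pi b); first by rewrite d_irr.
    have [->|bc] := eqVneq (pi b) (pi c); first by rewrite d_irr.
    have [->|ca] := eqVneq (pi c) (pi a); first by rewrite d_irr.
    rewrite -(rpi a) -(rpi b) -(rpi c) in ab bc ca *; rewrite -!pi_cross //.
    by apply: (P.2 (p (r y))).
(* By [fibre_component], [C] sends [p (r x)] to the component of [x], so it maps [L] onto the
   infinite components. *)
pose C q : set V := [set v | exists x, p (r x) = q /\ acyclic_component T x v].
rewrite cardE -(size_map C); apply: uniq_leq_size; first exact: fset_uniq.
move=> A; rewrite in_fset_set; last exact: finite_infinite_acyclic_components.
rewrite infinite_acyclic_componentsE => /set_mem[x /= inf <-].
apply/mapP; exists (p (r x)).
  by rewrite mem_enum inE; apply/asboolP; exists (r x); rewrite rpi.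
apply/seteqP; split => v /=; first by move=> xv; exists x.
by move=> [y [/fibre_component ->]].
Qed.

Lemma ratl_profile (F : numFieldType) : ratl k (fun n => (profile T n)%:R : F).
Proof.
have H := ratl_stabilizers (tournament_rel_irr T) (tournament_rel_asym T) d_irr
  pi_cross pi_acyclic F card_untruncated.
apply: ratl_ext H => n.
by rewrite profile_copies (sum_stabilizers F (@copies_eq n)).
Qed.

Lemma profile_geq : (0 < k)%N -> exists c m, forall n m',
  (c + #|I| * m' <= n -> m'.+1 ^ k.-1 <= m * profile T n)%N.
Proof.
move=> k0; have [s [p [L [us P red Linf kL]]]] := growable_presentation.
have /card_gt0P[z zL] : (0 < #|L|)%N by apply: leq_trans kL.
exists (weight (multiplicity s p)), #|{perm I}| => n m' le.
rewrite profile_copies.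
apply: leq_trans (card_admissibles_leq (@copies_eq n)).
have H := card_admissibles_geq (tournament_rel_irr T) (tournament_rel_asym T) d_irr
  pi_cross pi_acyclic us P red Linf zL le.
apply: leq_trans H.
by rewrite leq_pexp2l // -!subn1 leq_sub2r.
Qed.

End Presented.
End AcyclicComponents.

(** * From the rational count to the theorem *)

(** Burnside's sum needs a field; as [qfact] has integer coefficients, the numerator is nevertheless
    integral. *)
Lemma intr_smul_qfact (F : numFieldType) k (u : nat -> nat) n :
  (smul (qfact int k) (fun n => (u n)%:Z) n)%:~R =
  smul (qfact F k) (fun n => (u n)%:R) n.
Proof.
have -> : qfact F k = map_poly intr (qfact int k).
  rewrite /qfact rmorph_prod; apply: eq_bigr => i _.
  by rewrite rmorphB rmorph1 /= map_polyXn.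
rewrite rmorph_sum; apply: eq_bigr => i _.
by rewrite rmorphM coef_map /= pmulrn.
Qed.

Section LexicographicSumRelation.
Variables (I : Type) (D : tournament I) (W : I -> Type).
Variable S : forall i, tournament (W i).

Lemma lexsum_tag u v : tag u <> tag v -> lexsum D S u v <-> D (tag u) (tag v).
Proof.
move=> ne; split.
  move=> H; have {}H : lexsum_dominates D S u v := H.
  by case: H ne => [i x y _ []|].
by case: u v ne => [i x] [j y] /= _; right.
Qed.

Lemma lexsum_within i (x y : W i) : lexsum D S (Tagged W x) (Tagged W y) -> S i x y.
Proof.
have inj j (a b : W j) : Tagged W a = Tagged W b -> a = b.
  by move=> e; have := projT2_eq e; rewrite (Prop_irrelevance (projT1_eq e) erefl).
suff H u v : lexsum_dominates D S u v -> u = Tagged W x -> v = Tagged W y -> S i x y.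
  by move=> xy; apply: H xy erefl erefl.
case=> [j a b ab|j l a b jl] eu ev.
  have ij : j = i := congr1 (@tag I W) eu.
  case: _ / ij in x y eu ev *.
  by rewrite -(inj _ _ _ eu) -(inj _ _ _ ev).
have /= ij := congr1 (@tag I W) eu; have /= il := congr1 (@tag I W) ev.
by case: (@tournament_irreflexive _ D i); move: jl; rewrite ij il.
Qed.

End LexicographicSumRelation.

Lemma cvg_equivalent_pos (R : realType) (f : R^nat) (a : R) j : 0 < a ->
  (fun n : nat => f n / n%:R ^+ j) @ \oo --> a ->
  f ~_\oo (fun n : nat => a * n%:R ^+ j).
Proof.
move=> a0 /cvgrPdist_le H; apply/eqaddoP => e e0.
near=> n.
have n0 : 0 < (n%:R : R) ^+ j.
  by rewrite exprn_gt0 // ltr0n; near: n; exists 1%N.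
have : `|a - f n / n%:R ^+ j| <= e * a by near: n; apply: H; rewrite mulr_gt0.
rewrite !fctE normrM (gtr0_norm a0) (gtr0_norm n0) distrC => le.
have -> : f n - a * n%:R ^+ j = (f n / n%:R ^+ j - a) * n%:R ^+ j.
  by rewrite mulrBl divfK // gt_eqF.
by rewrite normrM (gtr0_norm n0) mulrA ler_wpM2r // ltW.
Unshelve. all: by end_near. Qed.

Theorem theorem1p7 (R : realType) (V : Type) (T : tournament V)
    (I : finType) (D : tournament I) (W : I -> Type)
    (S : forall i : I, tournament (W i))
    (S_acyclic : forall i : I, acyclic (S i))
    (T_lexsum : isomorphic T (lexsum D S)) :
  finite_set (infinite_acyclic_components T) /\
  let k := #|` fset_set (infinite_acyclic_components T)| in
  (exists P : {poly int},
     is_fraction (generating_series T) P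
       (\prod_(1 <= i < k.+1) (1 - 'X^i))) /\
  (exists a : R, 0 <= a /\
     (fun n : nat => (profile T n)%:R : R) ~_\oo
       (fun n : nat => a * n%:R ^ (k%:Z - 1))).
Proof.
have [g [gbij gT]] := T_lexsum.
(* Classical choice equips [V] with the structure required above. *)
pose V' : choiceType := {classic V}; pose T' : tournament V' := T.
pose pi (x : V') : I := tag (g x).
have pi_cross (x y : V') : pi x != pi y ->
    tournament_rel T' x y = `[< D (pi x) (pi y) >].
  move=> /eqP ne; have E := lexsum_tag D S ne.
  by apply/asboolP/asboolP => [/gT/E|/E/gT].
have pi_acyclic q : acyclic_on (tournament_rel T') (fun x => pi x = q).
  move=> x y z; rewrite /pi => ex ey ez /asboolP/gT xy /asboolP/gT yz.
  apply/asboolP => /gT zx.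
  case: (g x) (g y) (g z) => [i a] [j b] [l c] /= in ex ey ez xy yz zx.
  subst i j l; apply: (S_acyclic q); exists a, b, c.
  by split; apply: (@lexsum_within _ D W S q).
have fin : finite_set (infinite_acyclic_components T).
  exact: (finite_infinite_acyclic_components pi_cross pi_acyclic).
split=> // k.
have rat_T : ratl k (fun n => (profile T n)%:R : R).
  exact: (ratl_profile pi_cross pi_acyclic R).
split.
  have [N HN] := rat_T.
  (* The numerator is the product itself, cut at [N], from where it vanishes. *)
  exists (\poly_(n < N) smul (qfact int k) (generating_series T) n) => n.
  rewrite coef_poly -[LHS]/(smul (qfact int k) (generating_series T) n).
  case: ltnP => // Nn; apply: (@intr_inj R).
  by rewrite intr_smul_qfact HN.
have [k0|k0] := posnP k.
  (* Without infinite components the denominator is 1, so the profile is eventually zero. *)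
  exists 0; split => //; have [N HN] := rat_T.
  apply/eqaddoP => e e0; near=> n.
  have Nn : (N <= n)%N by near: n; exists N.
  have := HN n Nn.
  rewrite k0 /qfact big_geq // smul1 !fctE => ->.
  by rewrite mul0r subrr !normr0 mulr0.
have [j kj] : exists j, k = j.+1 by exists k.-1; rewrite prednK.
have [a Ha] : exists a, (fun n : nat => (profile T n)%:R / n%:R ^+ j) @ \oo --> (a : R).
  by apply: ratl_cvg; rewrite -kj.
have [c [m cm]] := profile_geq pi_cross pi_acyclic k0.
have a0 : 0 < a.
  have m0 : (0 < m)%N.
    have := cm (c + #|I| * 0)%N 0%N (leqnn _).
    by rewrite exp1n; case: (m).
  (* Taking [m'] as the quotient of [n - c] by [#|I|.+1] gives [n <= e * m'.+1], so the limit is at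
     least the inverse of [e ^ j * m]. *)
  pose e := (c + #|I|.+1)%N.
  have e0 : (0 < (e ^ j * m)%N%:R :> R) by rewrite ltr0n muln_gt0 expn_gt0 /e addnS m0.
  apply: (@lt_le_trans _ _ ((e ^ j * m)%N%:R^-1)); first by rewrite invr_gt0.
  rewrite -(cvg_lim _ Ha) //; apply: limr_ge; first by apply: cvgP Ha.
  near=> n; have cn : (c <= n)%N by near: n; exists c.
  have n0 : 0 < (n%:R : R) ^+ j.
    by rewrite exprn_gt0 // ltr0n; near: n; exists 1%N.
  rewrite ler_pdivlMr // mulrC ler_pdivrMr // -natrX -natrM ler_nat.
  pose m' := ((n - c) %/ #|I|.+1)%N.
  have dn := divn_eq (n - c) #|I|.+1; have rn := ltn_pmod (n - c) (ltn0Sn #|I|).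
  have le : (c + #|I| * m' <= n)%N by rewrite -/m' in dn; lia.
  have := cm n m' le; rewrite -[#|` _|]/k kj /= => leP.
  apply: (@leq_trans (e ^ j * m'.+1 ^ j)%N).
    rewrite -expnMn; have en : (n <= e * m'.+1)%N by rewrite -/m' in dn; rewrite /e; nia.
    by case: (j) => // j'; rewrite leq_exp2r.
  by rewrite [leqRHS]mulnC -mulnA leq_mul2l leP orbT.
exists a; split; first exact: ltW.
rewrite kj (_ : j.+1%:Z - 1 = j%:Z); last by lia.
exact: cvg_equivalent_pos.
Unshelve. all: by end_near. Qed.
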